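(* Let $I=[0,\gamma)$ with $0<\gamma\le\infty$. Let $\varphi$ be an Orlicz function that satisfies the $\Delta_2$-condition if $\gamma=\infty$, and the $\Delta_2^\infty$-condition if $\gamma<\infty$. Let $w$ and $(w_n)_{n=1}^\infty$ be weight functions on $I$, and put $W(t)=\int_0^t w(s)\,ds$ and $W_n(t)=\int_0^t w_n(s)\,ds$ for $n\ge1$. Suppose that (i) there are positive constants $(K_n)_{n=1}^\infty$ such that $W(t)\le K_n W_n(t)$ for all $t\in I$ and $n\in\mathbb{N}$, and (ii) $\Lambda_{\varphi,w_n}\subsetneq\Lambda_{\varphi,w_{n+1}}$ for every $n\in\mathbb{N}$. Then $\Lambda_{\varphi,w}\setminus\bigcup_{n=1}^\infty\Lambda_{\varphi,w_n}$ is maximal-spaceable (specifically, $\mathfrak{c}$-spaceable) in $\Lambda_{\varphi,w}$.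
   Context: The interval $I=[0,\gamma)$ carries Lebesgue measure $m$. $L_0$ is the space of real Lebesgue measurable functions on $I$ modulo a.e. equality. For $f\in L_0$, $d_f(\lambda)=m(\{t\in I:|f(t)|>\lambda\})$ for $\lambda>0$, and $f^*(t)=\inf\{\lambda>0:d_f(\lambda)\le t\}$ for $t\ge 0$ (with $\inf\varnothing=\infty$). An Orlicz function is a convex function $\varphi:[0,\infty)\to[0,\infty)$ with $\varphi(0)=0=\lim_{u\to0}\varphi(u)$ and $\varphi(u)>0$ for $u>0$ (put $\varphi(\infty)=\infty$). It satisfies the $\Delta_2^\infty$-condition if there are $K>2$, $u_0\ge0$ with $\varphi(2u)\le K\varphi(u)$ for all $u\ge u_0$; the $\Delta_2^0$-condition if there are $K>2$, $u_0>0$ with $\varphi(2u)\le K\varphi(u)$ for all $0\le u\le u_0$; the $\Delta_2$-condition if it satisfies both. A weight function on $I$ is a positive, decreasing (i.e. nonincreasing) function $w:I\setminus\{0\}\to(0,\infty)$ with $\int_0^t w<\infty$ for every $t\in I$; if $\gamma=\infty$ it is also assumed that $\int_0^\infty w=\infty$. The modular is $\rho_{\varphi,w}(f)=\int_I\varphi(f^*(t))w(t)\,dt$. The Orlicz-Lorentz space is $\Lambda_{\varphi,w}=\{f\in L_0:\rho_{\varphi,w}(kf)<\infty\text{ for some }k>0\}$ with the Luxemburg norm $\|f\|_{\varphi,w}=\inf\{\varepsilon>0:\rho_{\varphi,w}(f/\varepsilon)\le1\}$ (a Banach space). $\mathfrak{c}$ is the cardinality of the continuum; $\dim$ is algebraic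 dimension. A subset $A$ of a topological vector space $X$ is $\alpha$-spaceable in $X$ ($\alpha$ a cardinal) if there is a closed $\alpha$-dimensional vector subspace $M$ of $X$ with $M\subset A\cup\{0\}$; it is maximal-spaceable if it is $\dim(X)$-spaceable. *)

(* Defs.v *)
From HB Require Import structures.
From mathcomp Require Import all_boot all_order all_algebra.
From mathcomp Require Import all_classical all_reals all_analysis.
(* all_analysis does not export the algebraic structures on {mfun T >-> R}. *)
From mathcomp Require Import measurable_realfun.
Set Implicit Arguments.
Unset Strict Implicit.
Unset Printing Implicit Defensive.
Import Order.TTheory GRing.Theory Num.Theory.
Import numFieldNormedType.Exports.
Local Open Scope classical_set_scope.
Local Open Scope ring_scope.
Local Open Scope quotient_scope.
Local Open Scope card_scope.

(* The library's quotient {mfun_ mu, T >-> R} carries no algebraic structure. *)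
Definition mfun_ae d (T : measurableType d) (R : realType)
  (mu : {measure set T -> \bar R}) : Type := {mfun_ mu, T >-> R}.

Section mfun_ae_lmodType.
Context d (T : measurableType d) (R : realType).
Variable mu : {measure set T -> \bar R}.
Implicit Types (f g : {mfun T >-> R}) (u v : mfun_ae mu).

HB.instance Definition _ := Choice.on (mfun_ae mu).
HB.instance Definition _ := EqQuotient.on (mfun_ae mu).

Definition ae_class f : mfun_ae mu := \pi_({mfun_ mu, T >-> R}) f.
Definition ae_repr u : {mfun T >-> R} := repr u.

Lemma ae_classP f g :
  ae_class f = ae_class g <-> {ae mu, forall x, f x = g x}.
Proof.
split => [/eqmodP/asboolP|fg]; first by apply: filterS => x /(_ I).
by apply/eqmodP/asboolP; apply: filterS fg => x ? _.
Qed.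

Lemma ae_reprK u : ae_class (ae_repr u) = u.
Proof. exact: reprK. Qed.

Lemma ae_classK f : {ae mu, forall x, ae_repr (ae_class f) x = f x}.
Proof. by apply/ae_classP; rewrite ae_reprK. Qed.

Let add u v := ae_class (ae_repr u + ae_repr v).
Let zero := ae_class 0.
Let opp u := ae_class (- ae_repr u).
Let scale (a : R) u := ae_class (a *: ae_repr u).

Let classD f g : add (ae_class f) (ae_class g) = ae_class (f + g).
Proof.
apply/ae_classP.
apply: filterS2 (ae_classK f) (ae_classK g) => x fE gE.
by rewrite !mfunD /= fE gE.
Qed.

Let classN f : opp (ae_class f) = ae_class (- f).
Proof.
by apply/ae_classP; apply: filterS (ae_classK f) => x fE; rewrite !mfunN /= fE.
Qed.

Let classZ a f : scale a (ae_class f) = ae_class (a *: f).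
Proof.
apply/ae_classP; apply: filterS (ae_classK f) => x fE.
have E h : (a *: h : {mfun T >-> R}) x = a * h x by [].
by rewrite !E fE.
Qed.

Let addA : associative add.
Proof.
move=> u v w.
by rewrite -(ae_reprK u) -(ae_reprK v) -(ae_reprK w) !classD addrA.
Qed.

Let addC : commutative add.
Proof. by move=> u v; rewrite /add addrC. Qed.

Let add0 : left_id zero add.
Proof. by move=> u; rewrite -(ae_reprK u) classD add0r. Qed.

Let addN : left_inverse zero opp add.
Proof. by move=> u; rewrite -(ae_reprK u) classN classD addNr. Qed.

HB.instance Definition _ :=
  GRing.isZmodule.Build (mfun_ae mu) addA addC add0 addN.

Lemma ae_classD f g : ae_class f + ae_class g = ae_class (f + g).
Proof. exact: classD. Qed.

Lemma ae_classN f : - ae_class f = ae_class (- f).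
Proof. exact: classN. Qed.

Let scaleA a b u : scale a (scale b u) = scale (a * b) u.
Proof. by rewrite -(ae_reprK u) !classZ scalerA. Qed.

Let scale1 : left_id 1 scale.
Proof. by move=> u; rewrite -(ae_reprK u) classZ scale1r. Qed.

Let scaleDr : right_distributive scale +%R.
Proof.
move=> a u v; rewrite -(ae_reprK u) -(ae_reprK v).
by rewrite ae_classD !classZ ae_classD scalerDr.
Qed.

Let scaleDl u : {morph scale^~ u : a b / a + b}.
Proof.
by move=> a b; rewrite -(ae_reprK u) !classZ ae_classD scalerDl.
Qed.

HB.instance Definition _ :=
  GRing.Zmodule_isLmodule.Build R (mfun_ae mu) scaleA scale1 scaleDr scaleDl.

Lemma ae_classZ a f : a *: ae_class f = ae_class (a *: f).
Proof. exact: classZ. Qed.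

Lemma ae_class0 : ae_class 0 = 0.
Proof. by []. Qed.

End mfun_ae_lmodType.

Section lebesgue_interval.
Context {R : realType}.
Implicit Types gamma : \bar R.

Definition leb_itv gamma : set R := [set t | 0 <= t /\ (t%:E < gamma)%E].

Definition leb_oitv gamma : set R := [set t | 0 < t /\ (t%:E < gamma)%E].

Lemma measurable_leb_itv gamma :
  ((wlength idfun)^*)%mu.-cara.-measurable (leb_itv gamma).
Proof.
apply: sub_caratheodory.
suff [i ->] : exists i : interval R, leb_itv gamma = [set` i].
  exact: measurable_itv.
case: gamma => [g| |].
- exists `[0, g[; apply/seteqP; split=> t; rewrite /leb_itv/= in_itv/= lte_fin.
    by move=> [-> ->].
  by move=> /andP[].
- exists `[0, +oo[; apply/seteqP; split=> t; rewrite /leb_itv/= in_itv/= andbT.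
    by move=> [].
  by move=> t0; split => //; exact: ltry.
- by exists `]0, 0[; rewrite set_itv_ge ?bnd_simp//; apply/seteqP; split=> t [].
Qed.

(* Classes are represented by Lebesgue measurable functions on the whole of R;
   since the measure is restricted to [0, gamma), their values elsewhere are
   immaterial. *)
Definition L0 gamma : lmodType R :=
  mfun_ae (mrestr (@completed_lebesgue_measure R) (measurable_leb_itv gamma)).

Definition distribution_fun gamma (f : R -> R) (lambda : R) : \bar R :=
  completed_lebesgue_measure [set t | leb_itv gamma t /\ lambda < `|f t|].

Definition rearrangement gamma (f : R -> R) (t : R) : \bar R :=
  ereal_inf [set lambda%:E | lambda in
    [set lambda | 0 < lambda /\ (distribution_fun gamma f lambda <= t%:E)%E]].

End lebesgue_interval.

Section orlicz_weight.
Context {R : realType}.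
Implicit Types (gamma : \bar R) (phi w : R -> R).

(* The values of [phi] at negative reals are irrelevant. *)
Definition orlicz_function phi : Prop :=
  [/\ forall u, 0 <= u -> 0 <= phi u,
      @convex_function R R^o [set u : R | 0 <= u] phi,
      phi 0 = 0,
      phi u @[u --> 0^'+] --> (0 : R) &
      forall u, 0 < u -> 0 < phi u].

(* The convention phi(oo) = oo; the argument is never -oo. *)
Definition orlicz_ext phi (x : \bar R) : \bar R :=
  if x is r%:E then (phi r)%:E else +oo%E.

Definition delta2_infty phi : Prop :=
  exists K u0 : R, [/\ 2 < K, 0 <= u0 &
    forall u, u0 <= u -> phi (2 * u) <= K * phi u].

Definition delta2_zero phi : Prop :=
  exists K u0 : R, [/\ 2 < K, 0 < u0 &
    forall u, 0 <= u -> u <= u0 -> phi (2 * u) <= K * phi u].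

Definition delta2 phi : Prop := delta2_infty phi /\ delta2_zero phi.

Definition primitive w (t : R) : \bar R :=
  (\int[completed_lebesgue_measure]_(s in [set s | (0 < s < t)%R]) (w s)%:E)%E.

(* The values of [w] outside (0, gamma) are irrelevant. *)
Definition weight gamma w : Prop :=
  [/\ forall t, leb_oitv gamma t -> 0 < w t,
      forall s t, leb_oitv gamma s -> leb_oitv gamma t -> s <= t -> w t <= w s,
      forall t, leb_itv gamma t -> (primitive w t < +oo)%E &
      gamma = +oo%E ->
        (\int[completed_lebesgue_measure]_(s in leb_oitv gamma) (w s)%:E = +oo)%E].

End orlicz_weight.

Section orlicz_lorentz.
Context {R : realType}.
Variables (gamma : \bar R) (phi w : R -> R).
Implicit Types f : L0 gamma.

(* [w] is not defined at 0, so that null point is left out of the domain. *)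
Definition modular f : \bar R :=
  (\int[completed_lebesgue_measure]_(t in leb_oitv gamma)
     (orlicz_ext phi (rearrangement gamma (ae_repr f) t) * (w t)%:E))%E.

Definition orlicz_lorentz : set (L0 gamma) :=
  [set f | exists2 k : R, 0 < k & (modular (k *: f)%R < +oo)%E].

(* Extended-real valued: finite exactly on [orlicz_lorentz]. *)
Definition luxemburg_norm f : \bar R :=
  ereal_inf [set e%:E | e in
    [set e : R | 0 < e /\ (modular (e^-1 *: f)%R <= 1)%E]].

End orlicz_lorentz.

Arguments modular {R} gamma phi w f.
Arguments orlicz_lorentz {R} gamma phi w _.
Arguments luxemburg_norm {R} gamma phi w f.

Section spaceability.
Context {R : realType} {V : lmodType R}.
Implicit Types (X M A B : set V) (N : V -> \bar R).

Definition lin_indep B : Prop :=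
  forall (s : seq V) (c : V -> R), uniq s -> [set` s] `<=` B ->
    \sum_(v <- s) c v *: v = 0 -> forall v, v \in s -> c v = 0.

Definition lin_span B : set V :=
  [set u | exists (s : seq V) (c : V -> R),
    [set` s] `<=` B /\ u = \sum_(v <- s) c v *: v].

Definition hamel_basis M B : Prop := lin_indep B /\ lin_span B = M.

(* Cardinals are represented by sets: dim M = #|K|. *)
Definition has_dim (U : Type) M (K : set U) : Prop :=
  exists2 B, hamel_basis M B & B #= K.

(* [X] is a linear subspace of [V], normed by [N]; [norm_closed X N M] says
   that [M] is a closed subset of the normed space [X]. *)
Definition norm_closed X N M : Prop :=
  M `<=` X /\
  forall f, X f -> ~ M f ->
    exists2 e : R, 0 < e & forall g, X g -> (N (g - f)%R < e%:E)%E -> ~ M g.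

Definition spaceable (U : Type) X N A (K : set U) : Prop :=
  exists M, [/\ submod_closed (mem M), norm_closed X N M, has_dim M K &
                M `<=` A `|` [set 0]].

Definition maximal_spaceable X N A : Prop :=
  exists2 B, hamel_basis X B & spaceable X N A B.

End spaceability.

(* Main.v *)
Require Import Defs.
From mathcomp Require Import all_boot all_order all_algebra.
From mathcomp Require Import all_classical all_reals all_analysis.
From mathcomp Require Import measurable_realfun.
From mathcomp Require Import lra ring.
Import Order.TTheory GRing.Theory Num.Theory.
Import numFieldNormedType.Exports.
Local Open Scope classical_set_scope.
Local Open Scope ring_scope.
Set Implicit Arguments.
Unset Strict Implicit.
Unset Printing Implicit Defensive.

(** The intersection of the space of [w] with the complements of the spaces of the
[wn n] is shown to contain, up to 0, a closed subspace of functions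
[h(t) a(j(t))], where [h >= 0] is one fixed decreasing function, [j] one fixed
partition of the line into countably many classes, and [a] ranges over the sequences
for which the product lies in the space of [w].

The function [h]. Choose [f n] in the space of [wn n.+1] but not in that of [wn n].
A decreasing function is a superposition of indicators of intervals [(0, t)], so the
comparison of primitives bounds its integral against [w] by a multiple of its integral
against [wn n] ([weighted_integral_le_of_primitive]); in particular every [f n] is in
the space of [w]. By convexity small multiples [c n * f n] have summable
modulars, so that half the supremum of the rearrangements [(c n * f n)^*] is a
decreasing function [h] with finite modular for [w] that dominates a multiple of
each [(f n)^*] ([dominating_profile]).

The partition [j]. The class [j = i] occupies at least a fixed positive proportion of
every interval [(0, tau)] ([scale_invariant_partition]). If [a i <> 0], then the
rearrangement of [h (a o j)] at [t / C] is at least [|a i| h(t)], for some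
[C >= 1] that depends on [i]. Because a weight decreases, the dilation
[t |-> t / C] changes weighted integrals of decreasing functions by a factor at most
[C] ([weighted_integral_dilation]); hence [h (a o j)] lies in no space of a [wn n],
since no multiple of [f n] does ([step_not_orlicz_lorentz]). If instead [a] is bounded
by 1, the rearrangement is at most [h], and [h (a o j)] is in the space of [w].

Closedness. A small norm forces a small distribution function ([luxemburg_distr]),
so a sequence converging fast in norm converges almost everywhere
([luxemburg_ae_cvg]); an almost everywhere limit of functions [h (a_n o j)] is again
of this form, with the pointwise limits of the [a_n] as coefficients
([step_class_ae_lim]).

Dimension. The geometric sequences with ratios in [(0, 1)] give continuum many
independent elements ([geometric_indep]), which extend to bases of the subspace and of
the whole space ([hamel_extension]). No such basis is larger than the continuum,
because a measurable function is determined almost everywhere by the answers to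
countably many yes-or-no questions ([card_L0_le_real]). *)

(** * Bases and the continuum *)

Lemma submod_closed_span (R : realType) (V : lmodType R) (M B : set V) :
  submod_closed (mem M) -> B `<=` M -> lin_span B `<=` M.
Proof.
move=> [M0 ML] BM _ [s [c [sB ->]]].
elim: s sB => [|v s IH] sB; first by rewrite big_nil; apply/set_mem.
rewrite big_cons; apply/set_mem/ML; apply/mem_set.
  by apply/BM/sB; rewrite /= mem_head.
by apply: IH => u us; apply: sB; rewrite /= inE us orbT.
Qed.

Lemma lin_indepU1 (R : realType) (V : lmodType R) (B : set V) (u : V) :
  lin_indep B -> ~ lin_span B u -> lin_indep (B `|` [set u]).
Proof.
move=> indB nBu s c us sB s0.
pose s' := rem u s.
have us' : uniq s' by exact: rem_uniq.
have s'B : [set` s'] `<=` B.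
  move=> v /=; rewrite mem_rem_uniq// inE => /andP[vu vs].
  by have [//|/= vu'] := sB v vs; move: vu; rewrite vu' eqxx.
have [uins|unins] := boolP (u \in s); last first.
  apply: indB => // v vs; have [//|/= vu] := sB v vs.
  by move: unins; rewrite -vu vs.
have E : \sum_(v <- s) c v *: v = c u *: u + \sum_(v <- s') c v *: v.
  by rewrite (perm_big _ (perm_to_rem uins)) big_cons.
have [cu|cu] := eqVneq (c u) 0.
  have s'0 : \sum_(v <- s') c v *: v = 0 by move: s0; rewrite E cu scale0r add0r.
  move=> v vs; have [->//|vu] := eqVneq v u.
  by apply: (indB s') => //; rewrite mem_rem_uniq// inE vu.
exfalso; apply: nBu; exists s', (fun v => - (c u)^-1 * c v); split => //.
apply: (scalerI cu); rewrite scaler_sumr.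
rewrite (eq_bigr (fun v => - (c v *: v))); last first.
  by move=> v _; rewrite scalerA mulrA mulrN divff// mulN1r scaleNr.
by rewrite sumrN; apply/eqP; rewrite -subr_eq0 opprK -E s0.
Qed.

(** A maximal independent set between [B0] and [M] spans [M], since a vector of [M]
outside its span could be added to it. *)
Lemma hamel_extension (R : realType) (V : lmodType R) (M B0 : set V) :
  submod_closed (mem M) -> lin_indep B0 -> B0 `<=` M ->
  exists2 B, hamel_basis M B & B0 `<=` B.
Proof.
move=> Msub indB0 B0M.
(* adding [B0] inside the predicate makes the empty chain harmless *)
pose P A := lin_indep (A `|` B0) /\ A `<=` M.
have [F FP totF|A [[indA AM] Amax]] := @Zorn_bigcup _ P.
  split; last by apply: bigcup_sub => X /FP[].
  move=> s c us sF s0.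
  suff [X [PX sX]] : exists X, P X /\ [set` s] `<=` X `|` B0.
    by apply: (PX.1 s c).
  have [[X0 FX0]|F0] := pselect (F !=set0); last first.
    exists set0; split; first by split; rewrite ?set0U// => ? [].
    move=> v /sF[[X FX _]|]; last by right.
    by exfalso; apply: F0; exists X.
  suff [X [PX sX]] : exists X, F X /\ [set` s] `<=` X `|` B0.
    by exists X; split=> //; exact: FP.
  elim: s {us s0} sF => [|v s IH] sF; first by exists X0; split.
  have [u /= us|X [FX sX]] := IH; first by apply: sF; rewrite /= inE us orbT.
  have [[Y FY Yv]|B0v] := sF v (mem_head _ _); last first.
    exists X; split=> // u /=; rewrite inE => /orP[/eqP->|/sX//]; by right.
  have [XY|YX] := totF _ _ FX FY.
  - exists Y; split=> // u /=; rewrite inE => /orP[/eqP->|/sX[/XY|]];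
      [by left|by left|by right].
  - by exists X; split=> // u /=; rewrite inE => /orP[/eqP->|/sX//]; left; exact: YX.
exists (A `|` B0); last by move=> v; right.
split=> //; apply/seteqP; split.
  by apply: submod_closed_span => // v [/AM|/B0M].
move=> u Mu; apply: contrapT => nu.
apply: (Amax (A `|` [set u])).
  split; first by move=> v; left.
  move=> /(_ u (or_intror erefl)) Au.
  apply: nu; exists [:: u], (fun=> 1); split.
    by move=> v /=; rewrite inE => /eqP->; left.
  by rewrite big_seq1 scale1r.
split; last by move=> v [/AM//|->].
by rewrite setUAC; exact: lin_indepU1.
Qed.

(** A set of integers is read as a ternary expansion with digits 0 and 1; at the
first index where two sets differ the larger digit outweighs the whole tail of
the other expansion. *)
Lemma card_set_nat_le_real (R : realType) : ([set: set nat] #<= [set: R])%card.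
Proof.
pose d (A : set nat) (i : nat) : R := (`[< A i >] : nat)%:R * 3^-1 ^+ i.
pose S A n := \sum_(0 <= i < n) d A i.
pose f A := sup (range (S A)).
have d0 A i : 0 <= d A i by rewrite mulr_ge0// exprn_ge0.
have tail A n m : S A (n + m)%N <= S A n + 3^-1 ^+ n * (3 / 2).
  rewrite {1}/S (big_cat_nat _ (leq_addr m n))//= lerD2l.
  apply: le_trans (_ : \sum_(n <= i < n + m) 3^-1 ^+ i <= _).
    apply: ler_sum => i _; rewrite /d ler_piMl// ?exprn_ge0//.
    by case: asboolP.
  rewrite geometric_partial_tail.
  have := @geometric_le_lim R m (3^-1 ^+ n) 3^-1.
  have -> : (1 - 3^-1 : R)^-1 = 3 / 2 by field.
  by apply; rewrite ?exprn_ge0 ?ger0_norm//; lra.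
have ub A n : ubound (range (S A)) (S A n + 3^-1 ^+ n * (3 / 2)).
  move=> _ [m _ <-]; have [nm|mn] := leqP n m.
    by rewrite -(subnKC nm); exact: tail.
  rewrite -(subnKC (ltnW mn)) /S (big_cat_nat _ (leq_addr _ m))//= -addrA lerDl.
  by rewrite addr_ge0//; exact: sumr_ge0.
have lef A n : S A n <= f A.
  by apply: ub_le_sup; [exists (S A 0%N + 3^-1 ^+ 0 * (3 / 2)); exact: ub|exists n].
have fle A n : f A <= S A n + 3^-1 ^+ n * (3 / 2).
  by apply: ge_sup; [exists (S A 0%N), 0%N|exact: ub].
have key A B n : (forall i, (i < n)%N -> A i <-> B i) -> A n -> ~ B n -> f B < f A.
  move=> AB An Bn.
  have SE : S B n = S A n.
    apply: eq_big_nat => i /andP[_ /AB iAB]; rewrite /d.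
    by congr ((nat_of_bool _)%:R * _); apply/asbool_equiv_eq; split=> /iAB.
  have := fle B n.+1; have := lef A n.+1.
  rewrite /S !big_nat_recr//= -/(S A n) -/(S B n) SE /d asboolT// asboolF//.
  rewrite exprS mul1r mul0r.
  have : 0 < 3^-1 ^+ n :> R by rewrite exprn_gt0.
  set z := _ ^+ n; lra.
apply/pcard_injP; exists f => A B _ _ fAB.
apply: contrapT => nAB.
have [n Pn] : exists n, ~ (A n <-> B n).
  apply/existsNP => h; apply: nAB; apply/seteqP; split=> n; apply (h n).
have exn : exists n, `[< ~ (A n <-> B n) >] by exists n; exact/asboolP.
have [m /asboolP Pm min] := ex_minnP exn.
have lt i : (i < m)%N -> A i <-> B i.
  by move=> im; apply: contrapT => h; have := min i (asboolT h); rewrite leqNgt im.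
have [Am|Am] := pselect (A m); have [Bm|Bm] := pselect (B m).
- by apply: Pm.
- by have := key _ _ _ lt Am Bm; rewrite fAB ltxx.
- have := key B A m (fun i im => iff_sym (lt i im)) Bm Am.
  by rewrite fAB ltxx.
- by apply: Pm.
Qed.

(** * The number of classes of measurable functions *)

Notation LT R :=
  (caratheodory_type (((@wlength R idfun)^*)%mu)).
Notation lmeasurable :=
  (((wlength idfun)^*)%mu.-cara.-measurable).
Notation leb := completed_lebesgue_measure.

Lemma lmeasurable_interval (R : realType) (A : set R) :
  is_interval A -> lmeasurable A.
Proof. by move=> iA; apply: sub_caratheodory; exact: is_interval_measurable. Qed.

Lemma leb_itv_oo (R : realType) (a b : R) : a <= b ->
  leb `]a, b[%classic = (b - a)%:E.
Proof.
move=> ab; transitivity (lebesgue_measure `]a, b[%classic) => //.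
rewrite lebesgue_measure_itv/= lte_fin; case: ltP => // ba.
have -> : a = b by apply/eqP; rewrite eq_le ab ba.
by rewrite subrr.
Qed.

(** A set of positive measure fills more than the proportion 2/3 of some rational
interval: otherwise summing over an almost optimal cover by intervals would give
the set less measure than it has. *)
Lemma interval_density (R : realType) (F : set (LT R)) :
  lmeasurable F -> (0 < leb F)%E ->
  exists a b : rat, ratr a < ratr b :> R /\
    ((2 / 3 * (ratr b - ratr a))%:E < leb (F `&` `]ratr a, ratr b[%classic))%E.
Proof.
move=> mF F0; wlog Foo : F mF F0 / (leb F < +oo)%E.
  move=> wlg.
  pose G n := F `&` `]- n%:R, n%:R[%classic.
  have mG n : lmeasurable (G n).
    by apply: measurableI => //; apply/lmeasurable_interval/interval_is_interval.
  have [n Gn0] : exists n, (0 < leb (G n))%E.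
    apply: contrapT => /forallNP G0; move: F0; rewrite lt0e => /andP[+ _].
    apply/negP; rewrite negbK; apply/eqP.
    apply: subset_measure0 (_ : leb (\bigcup_n G n) = 0)%E => //.
    - exact: bigcupT_measurable.
    - move=> x Fx; exists (Num.bound `|x|) => //; split=> //=.
      by rewrite in_itv/= -ltr_norml archi_boundP.
    - apply/negligibleP; first exact: bigcupT_measurable.
      apply: negligible_bigcup => n; apply/negligibleP => //.
      by apply/eqP; rewrite eq_le measure_ge0 andbT leNgt; apply/negP/G0.
  have [|a [b [ab H]]] := wlg _ (mG n) Gn0.
    apply: (@le_lt_trans _ _ (leb `]- n%:R, n%:R[%classic)).
      apply: le_measure; rewrite ?inE//; last exact: subIsetr.
      exact/lmeasurable_interval/interval_is_interval.
    by rewrite leb_itv_oo ?ltry// (le_trans (_ : _ <= 0)) ?oppr_le0 ?ler0n.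
  exists a, b; split => //; apply: lt_le_trans H _.
  have mab := lmeasurable_interval (@interval_is_interval _ `]ratr a, ratr b[).
  apply: le_measure; rewrite ?inE.
  - exact: measurableI.
  - exact: measurableI.
  - by apply: setSI; exact: subIsetl.
have Ffin : leb F \is a fin_num by rewrite ge0_fin_numE ?measure_ge0.
have e0 : 0 < fine (leb F) / 3 by rewrite divr_gt0// fine_gt0// F0.
apply: contrapT => /forallNP nodense.
have nodense_rat (a b : rat) : ratr a < ratr b :> R ->
    (leb (F `&` `]ratr a, ratr b[%classic) <= (2 / 3 * (ratr b - ratr a))%:E)%E.
  move=> ab; rewrite leNgt; apply/negP => H.
  by apply: (nodense a); exists b.
have /lb_ereal_inf_adherent : leb F \is a fin_num by [].
move=> /(_ _ e0)[_/= [A [mA FA] <-] SA].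
have nodenseA k : (leb (F `&` A k) <= (2 / 3)%:E * wlength idfun (A k))%E.
  have [[x y] _ /= <-] := mA k.
  have [yx|xy] := leP y x.
    by rewrite set_itv_ge ?bnd_simp -?leNgt// setI0 measure0 wlength0 mule0.
  rewrite (wlength_itv_bnd _ _ _ (ltW xy))/= -EFinM.
  apply/lee_addgt0Pr => e eps0.
  have [a] : exists a : rat, ratr a \in `]x - e / 2, x[.
    by apply: rat_in_itvoo; lra.
  have [b] : exists b : rat, ratr b \in `]y, y + e / 2[.
    by apply: rat_in_itvoo; lra.
  rewrite !in_itv/= => /andP[yb by_] /andP[xa ax].
  apply: (@le_trans _ _ (leb (F `&` `]ratr a, ratr b[%classic))).
    apply: le_measure; rewrite ?inE.
    - by apply: measurableI => //; apply/lmeasurable_interval/interval_is_interval.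
    - by apply: measurableI => //; apply/lmeasurable_interval/interval_is_interval.
    - apply: setIS => t /=; rewrite !in_itv/= => /andP[xt ty].
      by rewrite (lt_trans ax xt) (le_lt_trans ty yb).
  have ab : ratr a < ratr b :> R by rewrite (lt_trans ax)// (lt_trans xy).
  apply: le_trans (nodense_rat _ _ ab) _.
  rewrite -EFinD lee_fin; lra.
have mAk k : lmeasurable (A k).
  by have [[x y] _ /= <-] := mA k; apply/lmeasurable_interval/interval_is_interval.
have : (leb F <= \sum_(k <oo) leb (F `&` A k))%E.
  apply: measure_sigma_subadditive => //; first by move=> k; exact: measurableI.
  by move=> t Ft; have [k _ Akt] := FA t Ft; exists k.
apply/negP; rewrite -ltNge.
apply: (@le_lt_trans _ _ ((2 / 3)%:E * \sum_(k <oo) wlength idfun (A k))%E).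
  rewrite -nneseriesZl//.
  by apply: lee_nneseries => // k _; exact: measure_ge0.
apply: (@le_lt_trans _ _ ((2 / 3)%:E * (leb F + (fine (leb F) / 3)%:E))%E).
  by rewrite lee_pmul2l ?lte_fin//; exact: ltW.
rewrite -(fineK Ffin) -EFinD -EFinM lte_fin.
have : 0 < fine (leb F) by rewrite fine_gt0// F0.
by lra.
Qed.

Lemma ae_restrP (R : realType) (gamma : \bar R) (P : R -> Prop) :
  {ae mrestr leb (measurable_leb_itv gamma), forall t, P t} <->
  leb.-negligible (leb_itv gamma `&` [set t | ~ P t]).
Proof.
have mI := @measurable_leb_itv R gamma.
split=> -[N [mN N0 PN]].
- exists (N `&` leb_itv gamma); split => //; first exact: measurableI.
  by move=> t [It Pt]; split => //; exact: PN.
- exists (N `|` ~` leb_itv gamma); split.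
  + by apply: measurableU => //; exact: measurableC.
  + rewrite /mrestr setIUl setICl setU0; apply/eqP; rewrite -measure_le0.
    rewrite -N0; apply: le_measure; rewrite ?inE//; exact: measurableI.
  + move=> t Pt; have [It|It] := pselect (leb_itv gamma t); last by right.
    by left; apply: PN; split.
Qed.

(** An interval on which [E `\` E'] has density 2/3 is more than half full of [E]
and at most one third full of [E']. *)
Lemma half_full_null_setD (R : realType) (E E' : set (LT R)) :
  lmeasurable E -> lmeasurable E' ->
  (forall a b : rat, ratr a < ratr b :> R ->
    ((1 / 2 * (ratr b - ratr a))%:E < leb (E `&` `]ratr a, ratr b[%classic))%E ->
    ((1 / 2 * (ratr b - ratr a))%:E < leb (E' `&` `]ratr a, ratr b[%classic))%E) ->
  leb (E `\` E') = 0%E.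
Proof.
move=> mE mE' EE'; apply/eqP; rewrite eq_le measure_ge0 andbT leNgt.
apply/negP => F0; have mF : lmeasurable (E `\` E') by exact: measurableD.
have [a [b [ab FJ]]] := interval_density mF F0.
move: EE' => /(_ _ _ ab).
move: ab FJ; move: (ratr a) (ratr b) => x y xy; set J := `]x, y[%classic => FJ.
have mJ : lmeasurable J by apply/lmeasurable_interval/interval_is_interval.
have mFJ : lmeasurable ((E `\` E') `&` J) by exact: measurableI.
have mEJ : lmeasurable (E `&` J) by exact: measurableI.
have mE'J : lmeasurable (E' `&` J) by exact: measurableI.
have yx0 : 0 < y - x by rewrite subr_gt0.
have FE : (leb ((E `\` E') `&` J) <= leb (E `&` J))%E.
  by apply: le_measure; rewrite ?inE//; apply: setSI; exact: subDsetl.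
have FE' : (leb (E' `&` J) + leb ((E `\` E') `&` J) <= leb J)%E.
  rewrite -measureU//; last by rewrite -subset0 => t [[? _] [[_ ?] _]].
  by apply: le_measure; rewrite ?inE//; [exact: measurableU|move=> t [][]].
rewrite leb_itv_oo in FE'; last exact: ltW.
move=> EE'; have {}EE' : ((1 / 2 * (y - x))%:E < leb (E' `&` J))%E.
  apply: EE'; apply: lt_le_trans FE; apply: lt_trans FJ.
  by rewrite lte_fin; move: (y - x) yx0 => z z0; lra.
have := lt_le_trans (lteD EE' FJ) FE'.
rewrite -EFinD lte_fin; move: (y - x) yx0 => z z0; lra.
Qed.

(** A class is determined by the rational rays and rational intervals for which
[{u > q}] fills more than half of the interval. *)
Lemma card_L0_le_real (R : realType) (gamma : \bar R) (A : set (L0 gamma)) :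
  (A #<= [set: R])%card.
Proof.
have [lev levE] : exists lev : L0 gamma -> rat -> set (LT R), forall u q,
    lev u q = leb_itv gamma `&` [set t | ratr q < ae_repr u t].
  by eexists => u q; reflexivity.
have mlev u q : lmeasurable (lev u q).
  rewrite levE; apply: measurableI; first exact: measurable_leb_itv.
  rewrite (_ : [set t | _] = ae_repr u @^-1` `]ratr q, +oo[%classic).
    exact: measurable_funPTI.
  by apply/seteqP; split=> t /=; rewrite in_itv/= andbT.
pose half (u : L0 gamma) (p : rat * rat * rat) : Prop :=
  ((1 / 2 * (ratr p.2 - ratr p.1.2))%:E <
    leb (lev u p.1.1 `&` `]ratr p.1.2, ratr p.2[%classic))%E.
pose code (u : L0 gamma) : set nat :=
  [set n | exists2 p, n = pickle p & half u p].
apply: card_le_trans (card_set_nat_le_real R).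
apply/pcard_injP; exists code => u v _ _ uv.
have diff u' v' q : code u' = code v' -> leb (lev u' q `\` lev v' q) = 0%E.
  move=> uv'; apply: (half_full_null_setD (mlev u' q) (mlev v' q)) => a b ab u'ab.
  have : code u' (pickle (q, a, b)) by exists (q, a, b).
  by rewrite uv' => -[p /(pcan_inj pickleK) <-].
rewrite -(ae_reprK u) -(ae_reprK v); apply/ae_classP.
apply/ae_restrP.
pose E (p : rat * bool) := if p.2 then lev u p.1 `\` lev v p.1
                           else lev v p.1 `\` lev u p.1.
have : leb.-negligible (\bigcup_n (if unpickle n is Some p then E p else set0)).
  apply: negligible_bigcup => n; case: unpickle => [[q []]|]; rewrite /E/=.
  - by apply/negligibleP; [exact: measurableD|exact: diff].
  - by apply/negligibleP; [exact: measurableD|exact: diff].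
  - exact: negligible_set0.
apply: negligibleS => t [It /= uvt].
have sep (x y : R) : x <> y -> exists q : rat, x < ratr q < y \/ y < ratr q < x.
  move=> xy; have [xy'|yx|//] := ltgtP x y.
  - by have [q] := rat_in_itvoo xy'; rewrite in_itv => q_; exists q; left.
  - by have [q] := rat_in_itvoo yx; rewrite in_itv => q_; exists q; right.
have [q [/andP[uq qv]|/andP[vq qu]]] := sep _ _ uvt.
- exists (pickle (q, false)); first exact: I.
  rewrite pickleK /E/= !levE.
  by split=> [|[_ /=]]; [split|rewrite ltNge (ltW uq)].
- exists (pickle (q, true)); first exact: I.
  rewrite pickleK /E/= !levE.
  by split=> [|[_ /=]]; [split|rewrite ltNge (ltW vq)].
Qed.

(** * Weighted integrals through level sets *)

(** Layer-cake formula: [U t] is the length of [{s | 0 <= s < U t}], and the order of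
integration is exchanged. The measurability of [F] is part of the conclusion because
comparing two such integrals over [s] calls for it again. *)
Lemma ge0_integral_levels d (T : measurableType d) (R : realType)
    (m : {sigma_finite_measure set T -> \bar R}) (U : T -> \bar R) (V : T -> R) :
  measurable_fun setT U -> measurable_fun setT V ->
  (forall t, 0 <= U t)%E -> (forall t, 0 <= V t) ->
  let F := fun p : T * measurableTypeR R =>
    ((V p.1)%:E * (\1_[set q : T * measurableTypeR R |
                       (0 <= q.2)%R /\ (q.2%:E < U q.1)%E] p)%:E)%E in
  measurable_fun setT F /\
  (\int[m]_t (U t * (V t)%:E) =
   \int[lebesgue_measure]_s \int[m]_t F (t, s))%E.
Proof.
move=> mU mV U0 V0 F.
have mA : measurable [set q : T * measurableTypeR R |
                       (0 <= q.2)%R /\ (q.2%:E < U q.1)%E].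
  rewrite [X in measurable X](_ : _ =
    (snd @^-1` `[0, +oo[%classic) `&`
    (setT `&` [set q : T * measurableTypeR R | (q.2%:E < U q.1)%E])).
    apply: measurableI.
      by rewrite -[X in measurable X]setTI; exact: measurable_snd.
    apply: measurable_lte => //.
      by apply/measurable_EFinP; exact: measurable_snd.
    by apply: measurableT_comp => //; exact: measurable_fst.
  rewrite setTI; apply/seteqP; split=> q /=; rewrite in_itv/= andbT.
  - by [].
  - by [].
have mF : measurable_fun setT F.
  apply: emeasurable_funM; apply/measurable_EFinP.
    by apply: measurableT_comp => //; exact: measurable_fst.
  exact: measurable_indic.
split=> //; rewrite -fubini_tonelli//; last first.
  by move=> p; rewrite /F mule_ge0// lee_fin// ?V0.
apply: eq_integral => t _; rewrite /F/=.
have mS : measurable [set s : measurableTypeR R | (0 <= s)%R /\ (s%:E < U t)%E].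
  apply: is_interval_measurable => x y [x0 _] [_ yU] z /andP[xz zy].
  by split; [exact: le_trans xz|apply: le_lt_trans yU; rewrite lee_fin].
rewrite ge0_integralZl//; first last.
- by rewrite lee_fin.
- by apply/measurable_EFinP; exact: (measurable_indic mS).
rewrite (eq_integral (fun s => (\1_[set s : measurableTypeR R |
    (0 <= s)%R /\ (s%:E < U t)%E] s)%:E)); last first.
  by move=> s _; rewrite !indicE; congr ((nat_of_bool _)%:R%:E); apply/idP/idP; rewrite !inE.
rewrite integral_indic// setIT muleC; congr (_ * _)%E.
have := U0 t; case: (U t) => [r| |]//; rewrite ?lee_fin => r0.
- rewrite (_ : [set s | _] = `[0, r[%classic); last first.
    by apply/seteqP; split=> s /=; rewrite in_itv/= lte_fin => /andP.
  transitivity (lebesgue_measure `[0, r[%classic) => //.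
  by rewrite lebesgue_measure_itv/= lte_fin sube0; case: ltgtP r0 => // <-.
- rewrite (_ : [set s | _] = `[0, +oo[%classic); last first.
    apply/seteqP; split=> s /=; rewrite in_itv/= andbT; first by case.
    by move=> s0; split=> //; exact: ltry.
  transitivity (lebesgue_measure `[0 : R, +oo[%classic) => //.
  by rewrite lebesgue_measure_itv/= ltry.
Qed.

(** Comparing the weights of all level sets compares the integrals. *)
Lemma ge0_le_integral_levels d (T : measurableType d) (R : realType)
    (m : {sigma_finite_measure set T -> \bar R}) (D : set T)
    (u v : T -> \bar R) (f g : T -> R) (C : R) :
  measurable D -> 0 <= C ->
  measurable_fun D u -> measurable_fun D v ->
  measurable_fun D f -> measurable_fun D g ->
  (forall t, D t -> 0 <= u t)%E -> (forall t, D t -> 0 <= v t)%E ->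
  (forall t, D t -> 0 <= f t) -> (forall t, D t -> 0 <= g t) ->
  (forall s : R, (0 <= s)%R ->
    \int[m]_(t in D `&` [set t | (s%:E < u t)%E]) (f t)%:E <=
    C%:E * \int[m]_(t in D `&` [set t | (s%:E < v t)%E]) (g t)%:E)%E ->
  (\int[m]_(t in D) (u t * (f t)%:E) <=
   C%:E * \int[m]_(t in D) (v t * (g t)%:E))%E.
Proof.
move=> mD C0 mu mv mf mg u0 v0 f0 g0 fg.
have restrict_int (k : T -> \bar R) (h : T -> R) :
    (\int[m]_(t in D) (k t * (h t)%:E) =
     \int[m]_t ((k \_ D) t * ((h \_ D) t)%:E))%E.
  rewrite integral_mkcond; apply: eq_integral => t _; rewrite !patchE.
  by case: ifPn; rewrite ?mul0e.
have level_int (k : T -> \bar R) (h : T -> R) (s : R) : 0 <= s ->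
    (\int[m]_(t in D `&` [set t | (s%:E < k t)%E]) (h t)%:E =
     \int[m]_t (((h \_ D) t)%:E * (\1_[set q : T * measurableTypeR R |
                       (0 <= q.2)%R /\ (q.2%:E < (k \_ D) q.1)%E] (t, s))%:E))%E.
  move=> s0; rewrite integral_mkcond; apply: eq_integral => t _.
  rewrite !patchE indicE; case: (boolP (t \in D)) => tD; last first.
    rewrite memNset ?mul0e//= => -[Dt _]; by move: tD; rewrite mem_set.
  have Dt : D t by exact: set_mem.
  have [st|st] := boolP (s%:E < k t)%E.
  - by rewrite !mem_set//= ?mule1// patchE tD.
  - rewrite !memNset//= ?mule0// ?patchE ?tD; first by case=> _; exact/negP.
    by case=> _; exact/negP.
have r0 (h : T -> R) : (forall t, D t -> 0 <= h t) -> forall t, 0 <= (h \_ D) t.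
  by move=> h0 t; rewrite patchE; case: ifPn => // /set_mem/h0.
have [mFu Eu] := @ge0_integral_levels _ _ _ m (u \_ D) (f \_ D)
  ((measurable_restrictT _ mD).1 mu) ((measurable_restrictT _ mD).1 mf)
  (erestrict_ge0 u0) (r0 _ f0).
have [mFv Ev] := @ge0_integral_levels _ _ _ m (v \_ D) (g \_ D)
  ((measurable_restrictT _ mD).1 mv) ((measurable_restrictT _ mD).1 mg)
  (erestrict_ge0 v0) (r0 _ g0).
rewrite !restrict_int Eu Ev.
have F0 (k : T -> \bar R) (h : T -> R) : (forall t, D t -> 0 <= h t) ->
  forall p : T * measurableTypeR R, (0 <= ((h \_ D) p.1)%:E *
   (\1_[set q : T * measurableTypeR R |
           (0 <= q.2)%R /\ (q.2%:E < (k \_ D) q.1)%E] p)%:E)%E.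
  by move=> h0 p; rewrite mule_ge0// lee_fin// r0.
rewrite -ge0_integralZl//; first last.
- by move=> s _; apply: integral_ge0 => t _; exact: F0.
- exact: (measurable_fun_fubini_tonelli_G _ mFv (F0 v g g0)).
apply: ge0_le_integral => //.
- by move=> s _; apply: integral_ge0 => t _; exact: F0.
- exact: (measurable_fun_fubini_tonelli_G _ mFu (F0 u f f0)).
- apply: measurable_funeM.
  exact: (measurable_fun_fubini_tonelli_G _ mFv (F0 v g g0)).
move=> s _; have [s0|s0] := leP 0 s.
  by rewrite -!level_int//; exact: fg.
rewrite !integral0_eq ?mule0// => t _; rewrite indicE memNset ?mule0//= => -[];
  by rewrite leNgt s0.
Qed.

Section weights.
Context (R : realType) (gamma : \bar R).
Implicit Types (w : R -> R) (A B : set (LT R)) (u v : R -> \bar R).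
Local Notation I0 := (leb_oitv gamma).

Definition initial A :=
  A `<=` I0 /\ forall s t, I0 s -> s <= t -> A t -> A s.

Definition noninc_on u := forall s t, I0 s -> I0 t -> s <= t -> (u t <= u s)%E.

Definition mass w A : \bar R := (\int[leb]_(t in A) (w t)%:E)%E.

Lemma leb_oitv_le (s t : R) : 0 < s -> s <= t -> I0 t -> I0 s.
Proof.
by move=> s0 st [t0 tg]; split=> //; apply: le_lt_trans tg; rewrite lee_fin.
Qed.

Lemma initial_full : initial I0.
Proof. by split=> // s t. Qed.

Lemma initial_measurable A : initial A -> lmeasurable A.
Proof.
move=> [AI Adown]; apply: lmeasurable_interval => x y Ax Ay z /andP[xz zy].
have z0 : 0 < z by have [x0 _] := AI _ Ax; exact: lt_le_trans xz.
exact: Adown (leb_oitv_le z0 zy (AI _ Ay)) zy Ay.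
Qed.

Lemma leb_oitv_measurable : lmeasurable I0.
Proof. exact/initial_measurable/initial_full. Qed.

Lemma initial_level u (s : \bar R) :
  noninc_on u -> initial (I0 `&` [set t | (s < u t)%E]).
Proof.
move=> ud; split=> [t []//|x y Ix xy [Iy /= sy]]; split=> //=.
by apply: lt_le_trans sy _; exact: ud.
Qed.

Lemma noninc_measurable u :
  noninc_on u -> measurable_fun (I0 : set (LT R)) u.
Proof.
move=> ud mI; apply: (measurability _ (ErealGenOInfty.measurableE R)) => //.
move=> /= _ [_ [x ->]] <-; rewrite preimage_itvoy.
exact/initial_measurable/initial_level.
Qed.

Lemma weight_pos w : weight gamma w -> forall t, I0 t -> 0 < w t.
Proof. by case. Qed.

Lemma weight_ge0 w : weight gamma w -> forall t, I0 t -> (0 <= (w t)%:E)%E.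
Proof. by move=> ww t It; rewrite lee_fin ltW// (weight_pos ww). Qed.

Lemma weight_noninc w : weight gamma w ->
  forall s t, I0 s -> I0 t -> s <= t -> w t <= w s.
Proof. by case. Qed.

Lemma weight_emeasurable w : weight gamma w ->
  measurable_fun (I0 : set (LT R)) (EFin \o w).
Proof.
move=> ww; apply: noninc_measurable => s t Is It st /=.
by rewrite lee_fin (weight_noninc ww).
Qed.

Lemma weight_measurable w : weight gamma w ->
  measurable_fun (I0 : set (LT R)) w.
Proof. by move=> /weight_emeasurable /measurable_EFinP. Qed.

Lemma mass_ge0 w A : weight gamma w -> A `<=` I0 -> (0 <= mass w A)%E.
Proof. by move=> ww AI; apply: integral_ge0 => t /AI; exact: weight_ge0. Qed.

Lemma mass_mono w A B : weight gamma w -> lmeasurable A -> lmeasurable B ->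
  A `<=` B -> B `<=` I0 -> (mass w A <= mass w B)%E.
Proof.
move=> ww mA mB AB BI; apply: (ge0_subset_integral _ mA mB _ _ AB).
- exact: measurable_funS leb_oitv_measurable BI (weight_emeasurable ww).
- by move=> t /BI; exact: weight_ge0.
Qed.

Lemma mass_le_cst w A (b : R) : weight gamma w -> lmeasurable A ->
  A `<=` I0 -> I0 b -> (forall t, A t -> b <= t) ->
  (mass w A <= (w b)%:E * leb A)%E.
Proof.
move=> ww mA AI Ib bA; rewrite -integral_cst//; apply: (ge0_le_integral _ mA).
- by move=> t /AI; exact: weight_ge0.
- exact: measurable_funS leb_oitv_measurable AI (weight_emeasurable ww).
- exact: measurable_cst.
- by move=> t At /=; rewrite lee_fin (weight_noninc ww)//; [exact: AI|exact: bA].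
Qed.

Lemma mass_ge_cst w A (b : R) : weight gamma w -> lmeasurable A ->
  A `<=` I0 -> I0 b -> (forall t, A t -> t <= b) ->
  ((w b)%:E * leb A <= mass w A)%E.
Proof.
move=> ww mA AI Ib bA; rewrite -integral_cst//; apply: (ge0_le_integral _ mA).
- by move=> t _; exact: weight_ge0.
- exact: measurable_cst.
- exact: measurable_funS leb_oitv_measurable AI (weight_emeasurable ww).
- by move=> t At /=; rewrite lee_fin (weight_noninc ww)//; [exact: AI|exact: bA].
Qed.

(** Since [w] decreases, the part of [A] beyond [b = sup B], which has length at most
[(C - 1) b], carries at most [C - 1] times the mass of [(0, b)]. *)
Lemma mass_dilation w A B (C : R) : weight gamma w -> initial A -> initial B ->
  1 <= C -> (forall t, A t -> B (t / C)) -> (mass w A <= C%:E * mass w B)%E.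
Proof.
move=> ww iA iB C1 AB.
have C0 : 0 < C by apply: lt_le_trans C1.
have mA := initial_measurable iA; have mB := initial_measurable iB.
have B0 := mass_ge0 ww iB.1.
have [AsubB|AnB] := pselect (A `<=` B).
  apply: le_trans (mass_mono ww mA mB AsubB iB.1) _.
  by rewrite -{1}[mass w B]mul1e lee_wpmul2r.
have [a [Aa nBa]] : exists a, A a /\ ~ B a.
  by apply: contrapT => /forallNP h; apply: AnB => t At; apply: contrapT => Bt;
    apply: (h t).
have Ia := iA.1 _ Aa.
have Ba : ubound B a.
  move=> t Bt; rewrite leNgt; apply/negP => at_; apply: nBa.
  exact: (iB.2 _ _ Ia (ltW at_) Bt).
have BaC := AB _ Aa.
have supB : has_sup B by split; [exists (a / C)|exists a].
pose b := sup B.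
have b_ub t : B t -> t <= b by apply: ub_le_sup; exists a.
have b0 : 0 < b by apply: lt_le_trans (b_ub _ BaC); case: (iB.1 _ BaC).
have ba : b <= a by apply: ge_sup Ba; exists (a / C).
have Ib : I0 b by exact: leb_oitv_le ba Ia.
have ltbB t : 0 < t -> t < b -> B t.
  move=> t0 /(sup_gt (proj1 supB))[b' Bb' tb'].
  by apply: (iB.2 _ _ _ (ltW tb') Bb'); exact: leb_oitv_le (ltW tb') (iB.1 _ Bb').
have b1 : ((w b)%:E * b%:E <= mass w B)%E.
  have mb : lmeasurable `]0, b[%classic by exact/lmeasurable_interval/interval_is_interval.
  apply: le_trans (mass_mono ww mb mB _ iB.1).
    have -> : b%:E = leb `]0, b[%classic by rewrite leb_itv_oo ?subr0// ltW.
    apply: mass_ge_cst => // t /=; rewrite in_itv/= => /andP[t0 tb]; last exact: ltW.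
    exact: leb_oitv_le (ltW tb) Ib.
  by move=> t /=; rewrite in_itv/= => /andP[]; exact: ltbB.
have mD : lmeasurable (A `\` B) by exact: measurableD.
have D1 : (mass w (A `\` B) <= (w b)%:E * ((C - 1) * b)%:E)%E.
  have DA t : (A `\` B) t -> b <= t <= C * b.
    move=> [At nBt]; apply/andP; split.
      apply: ge_sup; first by exists (a / C).
      move=> x Bx; rewrite leNgt; apply/negP => tx; apply: nBt.
      exact: (iB.2 _ _ (iA.1 _ At) (ltW tx) Bx).
    by rewrite mulrC -ler_pdivrMr//; exact/b_ub/AB.
  apply: le_trans (mass_le_cst (b := b) ww mD _ Ib _) _.
  - by move=> t [/iA.1].
  - by move=> t /DA/andP[].
  rewrite lee_wpmul2l ?(weight_ge0 ww)//.
  apply: (@le_trans _ _ (leb `[b, C * b]%classic)).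
    apply: le_measure; rewrite ?inE//.
    exact/lmeasurable_interval/interval_is_interval.
  have -> : leb `[b, C * b]%classic = lebesgue_measure `[b, C * b]%classic by [].
  rewrite lebesgue_measure_itv/= lte_fin; case: ifPn => _.
    by rewrite -EFinB lee_fin mulrBl mul1r.
  by rewrite lee_fin mulr_ge0 ?subr_ge0// ltW.
have wf (E : set (LT R)) : E `<=` I0 -> measurable_fun E (EFin \o w).
  by move=> EI; exact: measurable_funS leb_oitv_measurable EI (weight_emeasurable ww).
have AE : (mass w A <= mass w B + mass w (A `\` B))%E.
  have ABI : B `|` (A `\` B) `<=` I0 by move=> t [/iB.1//|[/iA.1]].
  have <- : mass w (B `|` (A `\` B)) = (mass w B + mass w (A `\` B))%E.
    apply: (ge0_integral_setU _ mB mD (wf _ ABI)).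
      by move=> t /ABI; exact: weight_ge0.
    by apply/disj_setPS => t [Bt [_]].
  apply: (mass_mono ww mA _ _ ABI); first exact: measurableU.
  by move=> t At; have [?|?] := pselect (B t); [left|right].
apply: le_trans AE _; have -> : C%:E = (1 + (C - 1)%:E)%E :> \bar R.
  by rewrite -EFinD addrC subrK.
rewrite ge0_muleDl ?lee_fin ?subr_ge0// mul1e leeD2l//.
apply: le_trans D1 _; rewrite EFinM muleCA lee_wpmul2l// lee_fin subr_ge0//.
Qed.

Definition weighted_integral w u : \bar R :=
  (\int[leb]_(t in I0) (u t * (w t)%:E))%E.

Lemma weighted_integral_dilation w u v (C : R) : weight gamma w ->
  noninc_on u -> noninc_on v ->
  (forall t, I0 t -> 0 <= u t)%E -> (forall t, I0 t -> 0 <= v t)%E ->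
  1 <= C -> (forall t, I0 t -> u t <= v (t / C)%R)%E ->
  (weighted_integral w u <= C%:E * weighted_integral w v)%E.
Proof.
move=> ww ud vd u0 v0 C1 uv.
have C0 : 0 < C by exact: lt_le_trans C1.
apply: ge0_le_integral_levels => //.
- exact: leb_oitv_measurable.
- exact: ltW.
- exact: noninc_measurable.
- exact: noninc_measurable.
- exact: weight_measurable.
- exact: weight_measurable.
- by move=> t It; rewrite ltW// (weight_pos ww).
- by move=> t It; rewrite ltW// (weight_pos ww).
move=> s s0; apply: mass_dilation => //; [exact: initial_level|exact: initial_level|].
move=> t [It /= st]; split; last by exact: lt_le_trans st (uv _ It).
have [t0 _] := It; apply: (leb_oitv_le _ _ It); first by rewrite divr_gt0.
by rewrite ler_pdivrMr// ler_peMr// ltW.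
Qed.

(** The comparison of primitives controls every interval [(0, t)] with [t] in the
interior. Any other initial set is contained in the dilation by 2 of such an interval
lying inside it, unless it is the whole half-line, where the mass of [w'] is
infinite. *)
Lemma mass_le_of_primitive w w' A (K : R) : weight gamma w -> weight gamma w' ->
  0 < K ->
  (forall t, leb_itv gamma t -> primitive w t <= K%:E * primitive w' t)%E ->
  initial A -> (mass w A <= (2 * K)%:E * mass w' A)%E.
Proof.
move=> ww ww' K0 WK iA.
have mA := initial_measurable iA.
have K20 : 0 <= 2 * K by rewrite mulr_ge0// ltW.
have [[x1 Ax1]|A0] := pselect (A !=set0); last first.
  have -> : A = set0 by apply/seteqP; split => t // At; apply: A0; exists t.
  by rewrite /mass !integral_set0 mule0.
have [ubA|nubA] := pselect (has_ubound A); last first.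
  have Apos t : 0 < t -> A t.
    move=> t0; apply: contrapT => nAt; apply: nubA; exists t => x Ax.
    rewrite leNgt; apply/negP => tx; apply: nAt.
    by apply: (iA.2 _ _ _ (ltW tx) Ax); exact: leb_oitv_le (ltW tx) (iA.1 _ Ax).
  have AE : A = I0 by apply/seteqP; split=> [t /iA.1//|t [t0 _]]; exact: Apos.
  have goo : gamma = +oo%E.
    case: gamma AE (iA.1 _ Ax1) => [g| |]// AE [x0]; last by rewrite ltNge leNye.
    rewrite lte_fin => xg; have g0 : 0 < g by exact: lt_trans xg.
    by have := Apos _ g0; rewrite AE => -[_]; rewrite ltxx.
  have [_ _ _ div] := ww'; have := div goo; rewrite -AE -/(mass w' A) => ->.
  by rewrite gt0_muley ?leey// lte_fin mulr_gt0.
pose a := sup A.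
have a_ub t : A t -> t <= a by exact: ub_le_sup.
have a0 : 0 < a by apply: lt_le_trans (a_ub _ Ax1); case: (iA.1 _ Ax1).
(* any [b] strictly between [a / 2] and [a] serves: then [A] contains [(0, b)] and is
   contained in its dilation by 2, whether or not [a] belongs to [A] *)
pose b := 2 * a / 3.
have b0 : 0 < b by rewrite divr_gt0// mulr_gt0.
have ba : b < a by rewrite /b; lra.
have Ab : A b.
  have [c Ac bc] := sup_gt (ex_intro _ _ Ax1) ba.
  by apply: (iA.2 _ _ _ (ltW bc) Ac); exact: leb_oitv_le (ltW bc) (iA.1 _ Ac).
have Ib := iA.1 _ Ab.
pose B : set (LT R) := [set s | 0 < s < b].
have BA : B `<=` A.
  by move=> s /andP[s0 sb]; apply: (iA.2 _ _ _ (ltW sb) Ab); exact: leb_oitv_le (ltW sb) Ib.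
have iB : initial B.
  split=> [s /BA /iA.1//|s t Is st /andP[t0 tb]]; apply/andP; split.
    by case: Is.
  exact: le_lt_trans tb.
apply: (@le_trans _ _ (2%:E * mass w B)%E).
  apply: mass_dilation => //; first by rewrite ler1n.
  move=> t At; have [t0 _] := iA.1 _ At; apply/andP; split; first by rewrite divr_gt0.
  by have := a_ub _ At; rewrite /b; lra.
rewrite EFinM -muleA lee_wpmul2l//.
have Ibb : leb_itv gamma b by case: Ib => b0' bg; split => //; exact: ltW.
apply: le_trans (WK b Ibb) _; apply: lee_wpmul2l; first by rewrite lee_fin ltW.
exact: (mass_mono ww' (initial_measurable iB) mA BA iA.1).
Qed.

Lemma weighted_integral_le_of_primitive w w' u (K : R) :
  weight gamma w -> weight gamma w' -> 0 < K ->
  (forall t, leb_itv gamma t -> primitive w t <= K%:E * primitive w' t)%E ->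
  noninc_on u -> (forall t, I0 t -> 0 <= u t)%E ->
  (weighted_integral w u <= (2 * K)%:E * weighted_integral w' u)%E.
Proof.
move=> ww ww' K0 WK ud u0; apply: ge0_le_integral_levels => //.
- exact: leb_oitv_measurable.
- by rewrite mulr_ge0// ltW.
- exact: noninc_measurable.
- exact: noninc_measurable.
- exact: weight_measurable.
- exact: weight_measurable.
- by move=> t It; rewrite ltW// (weight_pos ww).
- by move=> t It; rewrite ltW// (weight_pos ww').
by move=> s _; apply: mass_le_of_primitive => //; exact: initial_level.
Qed.

End weights.

(** * Rearrangements and Orlicz functions *)

Lemma leb_mono (R : realType) (A B : set R) :
  A `<=` B -> (leb (A : set (LT R)) <= leb (B : set (LT R)))%E.
Proof. exact: (le_outer_measure ((wlength idfun)^*)%mu). Qed.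

Lemma leb_setU_le (R : realType) (A B : set R) :
  (leb (A `|` B : set (LT R)) <= leb (A : set (LT R)) + leb (B : set (LT R)))%E.
Proof. exact: (outer_measureU2 ((wlength idfun)^*)%mu). Qed.

Lemma leb_negligible0 (R : realType) (N : set (LT R)) :
  leb.-negligible N -> leb N = 0%E.
Proof.
move=> [A [mA A0 NA]]; apply/eqP; rewrite eq_le measure_ge0 andbT -A0.
exact: leb_mono.
Qed.

Section rearrangement.
Context (R : realType) (gamma : \bar R).
Implicit Types (f g h : R -> R) (s t l : R).
Local Notation I := (leb_itv gamma).
Local Notation distr := (distribution_fun gamma).
Local Notation rearr := (rearrangement gamma).

Lemma distr_noninc f l l' : l <= l' -> (distr f l' <= distr f l)%E.
Proof. by move=> ll'; apply: leb_mono => t [It /= lt]; split=> //; exact: le_lt_trans lt. Qed.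

Lemma distr_le_max f g h l :
  leb.-negligible (I `&` [set t | ~ `|h t| <= Num.max `|f t| `|g t|]) ->
  (distr h l <= distr f l + distr g l)%E.
Proof.
move=> /leb_negligible0 N0.
apply: le_trans (leb_setU_le _ _).
rewrite -[leRHS]adde0 -[in leRHS]N0; apply: le_trans (leb_setU_le _ _).
apply: leb_mono => t [It /= lt].
have [hfg|] := pselect (`|h t| <= Num.max `|f t| `|g t|); last by right.
by left; move: (lt_le_trans lt hfg); rewrite lt_max => /orP[]; [left|right].
Qed.

Lemma distr_le f h l : leb.-negligible (I `&` [set t | ~ `|h t| <= `|f t|]) ->
  (distr h l <= distr f l)%E.
Proof.
move=> /leb_negligible0 N0.
rewrite -[leRHS]adde0 -[in leRHS]N0; apply: le_trans (leb_setU_le _ _).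
apply: leb_mono => t [It /= lt].
have [hf|] := pselect (`|h t| <= `|f t|); last by right.
by left; split=> //; exact: lt_le_trans hf.
Qed.

Lemma distrZ (c : R) f l : 0 < c -> distr (fun t => c * f t) (c * l) = distr f l.
Proof.
move=> c0; congr leb; apply/seteqP; split=> t [It /=];
  by rewrite normrM gtr0_norm// ltr_pM2l.
Qed.

Lemma rearr_ge0 f t : (0 <= rearr f t)%E.
Proof. by apply: le_ereal_inf_tmp => _ [l [l0 _] <-]; rewrite lee_fin ltW. Qed.

Lemma rearr_noninc f s t : s <= t -> (rearr f t <= rearr f s)%E.
Proof.
move=> st; apply: le_ereal_inf => _ [l [l0 ls] <-]; exists l => //.
by split=> //; apply: le_trans ls _; rewrite lee_fin.
Qed.

Lemma rearr_le f t l : 0 < l -> (distr f l <= t%:E)%E -> (rearr f t <= l%:E)%E.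
Proof. by move=> l0 lt; apply: ereal_inf_lbound; exists l. Qed.

Lemma rearr_ge f t l : (t%:E < distr f l)%E -> (l%:E <= rearr f t)%E.
Proof.
move=> tl; apply: le_ereal_inf_tmp => _ [l' [l'0 l't] <-]; rewrite lee_fin.
rewrite leNgt; apply/negP => l'l; move: tl; apply/negP; rewrite -leNgt.
by apply: le_trans l't; exact/distr_noninc/ltW.
Qed.

Lemma rearr_lt_distr f t l : (rearr f t < l%:E)%E -> (distr f l <= t%:E)%E.
Proof.
by move=> /ereal_inf_lt[_ [l' [l'0 l't] <-]]; rewrite lte_fin => l'l;
  apply: le_trans l't; exact/distr_noninc/ltW.
Qed.

Lemma rearr_le_rearr f g t :
  leb.-negligible (I `&` [set t | ~ `|f t| <= `|g t|]) ->
  (rearr f t <= rearr g t)%E.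
Proof.
move=> fg; apply: le_ereal_inf => _ [l [l0 lt] <-]; exists l => //; split=> //.
by apply: le_trans lt; exact: distr_le.
Qed.

(** The argument is halved because the sets where [f] and [g] exceed a level, each of
measure at most [t / 2], have a union of measure at most [t]. *)
Lemma rearr_le_max f g h t :
  leb.-negligible (I `&` [set t | ~ `|h t| <= Num.max `|f t| `|g t|]) ->
  (rearr h t <= Order.max (rearr f (t / 2)%R) (rearr g (t / 2)%R))%E.
Proof.
move=> hfg; set m := Order.max _ _.
have : (0 <= m)%E by rewrite le_max rearr_ge0.
case mE : m => [r| |]; [|by rewrite !leey|by rewrite leNgt ltNy0].
rewrite lee_fin => r0; apply/lee_addgt0Pr => e e0; rewrite -EFinD.
have /andP[fr gr] : ((rearr f (t / 2)%R < (r + e)%:E) &&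
                     (rearr g (t / 2)%R < (r + e)%:E))%E.
  by rewrite -gt_max -/m mE lte_fin ltrDl.
apply: rearr_le; first by rewrite ltr_wpDl.
apply: le_trans (distr_le_max _ hfg) _.
rewrite (splitr t) EFinD; apply: leeD; exact: rearr_lt_distr.
Qed.

Lemma rearrZ (c : R) f t : 0 < c ->
  rearr (fun t => c * f t) t = (c%:E * rearr f t)%E.
Proof.
have le (k : R) (h : R -> R) : 0 < k ->
    (rearr (fun t => k * h t)%R t <= k%:E * rearr h t)%E.
  move=> k0; rewrite -lee_pdivrMl//; apply: le_ereal_inf_tmp => _ [l [l0 lt] <-].
  rewrite lee_pdivrMl// -EFinM; apply: rearr_le; first exact: mulr_gt0.
  by rewrite distrZ.
move=> c0; apply/eqP; rewrite eq_le le//= -lee_pdivlMl//.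
have := @le c^-1 (fun t => c * f t); rewrite invr_gt0 => /(_ c0).
by under [in X in (X <= _)%E -> _]eq_fun do rewrite mulKf ?gt_eqF//.
Qed.

End rearrangement.

Section orlicz_functions.
Context (R : realType) (phi : R -> R).
Hypothesis phiO : orlicz_function phi.

Lemma orlicz_ge0 u : 0 <= u -> 0 <= phi u.
Proof. by case: phiO => + _ _ _ _; exact. Qed.

Lemma orlicz0 : phi 0 = 0.
Proof. by case: phiO. Qed.

Lemma orlicz_gt0 u : 0 < u -> 0 < phi u.
Proof. by case: phiO => _ _ _ _; exact. Qed.

(** Convexity on the segment from 0 to [u]. *)
Lemma orlicz_starshaped (k u : R) : 0 <= k <= 1 -> 0 <= u ->
  phi (k * u) <= k * phi u.
Proof.
move=> /andP[k0 k1] u0; have [_ + _ _ _] := phiO.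
move=> /(_ (Itv01 k0 k1) u 0); rewrite !inE/= => /(_ u0 (lexx _)) cvx.
have : phi (k * u + (1 - k) * 0) <= k * phi u + (1 - k) * phi 0 := cvx.
by rewrite orlicz0 !mulr0 !addr0.
Qed.

Lemma orlicz_homo u v : 0 <= u -> u <= v -> phi u <= phi v.
Proof.
move=> u0 uv; have [v0|v0] := eqVneq v 0.
  by have -> : u = v by apply/eqP; rewrite eq_le uv v0 u0.
have v_gt0 : 0 < v by rewrite lt_neqAle eq_sym v0 (le_trans u0).
have uv1 : 0 <= u / v <= 1 by rewrite divr_ge0 ?(ltW v_gt0)//= ler_pdivrMr// mul1r.
have := orlicz_starshaped uv1 (ltW v_gt0); rewrite divfK// => /le_trans; apply.
by rewrite ler_piMl ?orlicz_ge0 ?(ltW v_gt0)//; case/andP: uv1.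
Qed.

(** This growth is what makes [phi] large at large arguments: it bounds an argument by
the value there, and it lets a modular exceed 1. *)
Lemma orlicz_growth u : 1 <= u -> u * phi 1 <= phi u.
Proof.
move=> u1; have u0 : 0 < u by exact: lt_le_trans u1.
have ui : 0 <= u^-1 <= 1 by rewrite invr_ge0 ltW//= invf_le1.
have := orlicz_starshaped ui (ltW u0); rewrite mulVf ?gt_eqF// => h.
by rewrite -ler_pdivlMl.
Qed.

Lemma orlicz_ext_ge0 (x : \bar R) : (0 <= x -> 0 <= orlicz_ext phi x)%E.
Proof. by case: x => [r| |]//=; rewrite !lee_fin; exact: orlicz_ge0. Qed.

Lemma orlicz_ext_homo (x y : \bar R) :
  (0 <= x -> x <= y -> orlicz_ext phi x <= orlicz_ext phi y)%E.
Proof.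
case: x y => [r| |] [s| |]//=; rewrite ?lee_fin ?leey//.
exact: orlicz_homo.
Qed.

Lemma orlicz_ext_starshaped (k : R) (x : \bar R) : 0 < k <= 1 ->
  (0 <= x -> orlicz_ext phi (k%:E * x) <= k%:E * orlicz_ext phi x)%E.
Proof.
move=> /andP[k0 k1]; case: x => [r| |]//=; rewrite ?lee_fin.
  by move=> r0; apply: orlicz_starshaped => //; rewrite ltW.
by move=> _; rewrite !gt0_muley ?lte_fin// leey.
Qed.

End orlicz_functions.

(** * Orlicz-Lorentz spaces as vector spaces *)

Definition to_L0 (R : realType) (gamma : \bar R) (f : {mfun LT R >-> R}) : L0 gamma :=
  ae_class (mrestr leb (measurable_leb_itv gamma)) f.

Section ae_representatives.
Context (R : realType) (gamma : \bar R).
Implicit Types (u v : L0 gamma) (P : R -> Prop).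

(** Equivalent to holding almost everywhere for the restricted measure ([ae_restrP]), in
a form that combines with the monotonicity and subadditivity of [leb]. *)
Definition ae_on P : Prop := leb.-negligible (leb_itv gamma `&` [set t | ~ P t]).

Lemma ae_on2 P Q S : (forall t, leb_itv gamma t -> P t -> Q t -> S t) ->
  ae_on P -> ae_on Q -> ae_on S.
Proof.
move=> h aP aQ; apply: negligibleS (negligibleU aP aQ) => t [It /= nS].
have [Pt|nP] := pselect (P t); last by left.
by right; split=> // Qt; apply: nS; exact: h.
Qed.

Lemma ae_onS P Q : (forall t, leb_itv gamma t -> P t -> Q t) ->
  ae_on P -> ae_on Q.
Proof. by move=> h aP; apply: (ae_on2 _ aP aP) => t It Pt _; exact: h. Qed.

Lemma ae_repr_eqP u v : u = v <-> ae_on (fun t => ae_repr u t = ae_repr v t).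
Proof.
rewrite -[in X in X <-> _](ae_reprK u) -[in X in X <-> _](ae_reprK v).
split=> [/ae_classP/ae_restrP //|uv]; apply/ae_classP/ae_restrP/uv.
Qed.

Lemma ae_repr_class (f : {mfun LT R >-> R}) :
  ae_on (fun t => ae_repr (to_L0 gamma f) t = f t).
Proof. exact/ae_restrP/ae_classK. Qed.

Lemma ae_reprZ (a : R) u : ae_on (fun t => ae_repr (a *: u) t = a * ae_repr u t).
Proof.
have := ae_repr_class (a *: ae_repr u).
by rewrite /to_L0 -ae_classZ ae_reprK; apply: ae_onS => t _ ->.
Qed.

Lemma ae_reprD u v :
  ae_on (fun t => ae_repr (u + v) t = ae_repr u t + ae_repr v t).
Proof.
have := ae_repr_class (ae_repr u + ae_repr v).
rewrite /to_L0 -ae_classD !ae_reprK; apply: ae_onS => t _ ->.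
by rewrite mfunD.
Qed.

Lemma ae_repr0 : ae_on (fun t => ae_repr (0 : L0 gamma) t = 0).
Proof. by have := ae_repr_class 0; rewrite /to_L0 ae_class0; apply: ae_onS => t _ ->. Qed.

End ae_representatives.

Lemma scaled_comb_le_max (R : realType) (a k l : R) : 0 < k -> 0 < l ->
  exists2 b : R, 0 < b &
    forall x y, `|b * (a * x + y)| <= Num.max `|k * x| `|l * y|.
Proof.
move=> k0 l0; pose b := Num.min (k / (2 * (1 + `|a|))) (l / 2).
have a1 : 0 < 1 + `|a| by rewrite ltr_wpDr.
have b0 : 0 < b by rewrite lt_min !divr_gt0// mulr_gt0.
exists b => // x y.
have ba : b * `|a| <= k / 2.
  apply: (@le_trans _ _ (k / (2 * (1 + `|a|)) * `|a|)).
    by rewrite ler_wpM2r// ge_min lexx.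
  rewrite invfM mulrA -mulrA ler_piMr//; first by rewrite divr_ge0// ltW.
  by rewrite mulrC ler_pdivrMr// mul1r lerDr.
have bl : b <= l / 2 by rewrite ge_min lexx orbT.
rewrite !normrM (gtr0_norm b0) (gtr0_norm k0) (gtr0_norm l0).
apply: (@le_trans _ _ (k / 2 * `|x| + l / 2 * `|y|)).
  apply: (@le_trans _ _ (b * `|a| * `|x| + b * `|y|)).
    by rewrite -mulrA -mulrDr ler_wpM2l ?(ltW b0)// -normrM ler_normD.
  by apply: lerD; apply: ler_wpM2r.
set X := k * `|x|; set Y := l * `|y|.
have -> : k / 2 * `|x| + l / 2 * `|y| = (X + Y) / 2 by rewrite /X /Y; lra.
have : X <= Num.max X Y by rewrite le_max lexx.
have : Y <= Num.max X Y by rewrite le_max lexx orbT.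
by lra.
Qed.

Section orlicz_lorentz_spaces.
Context (R : realType) (gamma : \bar R) (phi : R -> R).
Hypothesis phiO : orlicz_function phi.
Implicit Types (w : R -> R) (f g h : R -> R) (u v : L0 gamma).
Local Notation aeI := (ae_on gamma).

Definition orlicz_rearr f (t : R) := orlicz_ext phi (rearrangement gamma f t).

Definition fun_modular w f := weighted_integral gamma w (orlicz_rearr f).

Lemma orlicz_rearr_ge0 f t : (0 <= orlicz_rearr f t)%E.
Proof. by apply: orlicz_ext_ge0 => //; exact: rearr_ge0. Qed.

Lemma orlicz_rearr_noninc f : noninc_on gamma (orlicz_rearr f).
Proof.
by move=> s t _ _ st; apply: orlicz_ext_homo => //; [exact: rearr_ge0|exact: rearr_noninc].
Qed.

Lemma fun_modular_le w f g : weight gamma w ->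
  aeI (fun t => `|f t| <= `|g t|) -> (fun_modular w f <= fun_modular w g)%E.
Proof.
move=> ww fg; rewrite -[leRHS]mul1e; apply: weighted_integral_dilation => //.
- exact: orlicz_rearr_noninc.
- exact: orlicz_rearr_noninc.
- by move=> *; exact: orlicz_rearr_ge0.
- by move=> *; exact: orlicz_rearr_ge0.
- move=> t It; rewrite divr1; apply: orlicz_ext_homo => //; first exact: rearr_ge0.
  exact: rearr_le_rearr.
Qed.

(** This replaces a triangle inequality; the factor 2 is the price of the halved
argument in [rearr_le_max], by [weighted_integral_dilation]. *)
Lemma fun_modular_max w f g h : weight gamma w ->
  aeI (fun t => `|h t| <= Num.max `|f t| `|g t|) ->
  (fun_modular w h <= 2%:E * (fun_modular w f + fun_modular w g))%E.
Proof.
move=> ww hfg.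
have mI := @leb_oitv_measurable R gamma.
have -> : (fun_modular w f + fun_modular w g =
    weighted_integral gamma w (fun t => orlicz_rearr f t + orlicz_rearr g t))%E.
  have m k : measurable_fun (leb_oitv gamma : set (LT R))
      (fun t => orlicz_rearr k t * (w t)%:E)%E.
    apply: emeasurable_funM; last exact: weight_emeasurable.
    exact/noninc_measurable/orlicz_rearr_noninc.
  have ge0 k t : leb_oitv gamma t -> (0 <= orlicz_rearr k t * (w t)%:E)%E.
    by move=> It; apply: mule_ge0; [exact: orlicz_rearr_ge0|exact: weight_ge0 It].
  rewrite /fun_modular /weighted_integral.
  rewrite -(ge0_integralD _ mI (ge0 f) (m f) (ge0 g) (m g)).
  by apply: eq_integral => t _; rewrite ge0_muleDl//; exact: orlicz_rearr_ge0.
apply: weighted_integral_dilation => //.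
- exact: orlicz_rearr_noninc.
- by move=> s t Is It st; apply: leeD; exact: orlicz_rearr_noninc.
- by move=> *; exact: orlicz_rearr_ge0.
- by move=> *; apply: adde_ge0; exact: orlicz_rearr_ge0.
- by rewrite ler1n.
move=> t It; have := rearr_le_max t hfg.
move=> /(orlicz_ext_homo phiO (rearr_ge0 _ _ _)) /le_trans; apply.
rewrite /orlicz_rearr maxEle; case: ifPn => _.
- by rewrite leeDr//; exact: orlicz_rearr_ge0.
- by rewrite leeDl//; exact: orlicz_rearr_ge0.
Qed.

Lemma orlicz_lorentz_class w (f : {mfun LT R >-> R}) : weight gamma w ->
  orlicz_lorentz gamma phi w (to_L0 gamma f) <->
  exists2 k : R, 0 < k & (fun_modular w (fun t => k * f t)%R < +oo)%E.
Proof.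
move=> ww; have aeE k : aeI (fun t => ae_repr (k *: to_L0 gamma f) t = k * f t).
  by apply: (ae_on2 _ (ae_reprZ k (to_L0 gamma f)) (ae_repr_class gamma f)) =>
    t _ -> ->.
split=> -[k k0 H]; exists k; try exact: k0.
- apply: le_lt_trans H; apply: (fun_modular_le ww).
  by apply: ae_onS (aeE k) => t _ ->.
- apply: le_lt_trans H; apply: (fun_modular_le ww).
  by apply: ae_onS (aeE k) => t _ ->.
Qed.

Lemma orlicz_lorentzP w u : weight gamma w ->
  orlicz_lorentz gamma phi w u <->
  exists2 k : R, 0 < k & (fun_modular w (fun t => k * ae_repr u t)%R < +oo)%E.
Proof. by move=> ww; have := @orlicz_lorentz_class w (ae_repr u) ww; rewrite /to_L0 ae_reprK. Qed.

Lemma orlicz_lorentz_submod w : weight gamma w ->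
  submod_closed (mem (orlicz_lorentz gamma phi w)).
Proof.
move=> ww; split.
  apply/mem_set/(orlicz_lorentzP _ ww); exists 1; first exact: ltr01.
  rewrite (_ : fun_modular _ _ = 0%E)//; apply: integral0_eq => t It.
  rewrite /orlicz_rearr (_ : rearrangement _ _ _ = 0%E) ?(orlicz0 phiO) ?mul0e//=.
    by rewrite (orlicz0 phiO) mul0e.
  apply/eqP; rewrite eq_le rearr_ge0 andbT; apply/lee_addgt0Pr => e e0.
  rewrite add0e; apply: rearr_le => //.
  apply: (@le_trans _ _ 0%E); last by rewrite lee_fin ltW//; case: It.
  rewrite -(leb_negligible0 (ae_repr0 gamma)); apply: leb_mono => s [Is /= es].
  by split=> //= s0; move: es; rewrite s0 mulr0 normr0 ltNge (ltW e0).
move=> a u v /set_mem/(orlicz_lorentzP _ ww)[k k0 ku].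
move=> /set_mem/(orlicz_lorentzP _ ww)[l l0 lv].
apply/mem_set/(orlicz_lorentzP _ ww).
have [b b0 bE] := scaled_comb_le_max a k0 l0.
exists b; first exact: b0.
have auv : aeI (fun t =>
    ae_repr (a *: u + v) t = a * ae_repr u t + ae_repr v t).
  by apply: (ae_on2 _ (ae_reprZ a u) (ae_reprD (a *: u) v)) => t _ <-.
have huv : aeI (fun t => `|b * ae_repr (a *: u + v) t| <=
    Num.max `|k * ae_repr u t| `|l * ae_repr v t|).
  by apply: ae_onS auv => t _ ->; exact: bE.
apply: le_lt_trans (fun_modular_max ww huv) _.
apply: lte_mul_pinfty; [by rewrite lee_fin|by []|].
exact: lte_add_pinfty ku lv.
Qed.

Lemma orlicz_lorentz_sub w w' (K : R) : weight gamma w -> weight gamma w' ->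
  0 < K ->
  (forall t, leb_itv gamma t -> primitive w t <= K%:E * primitive w' t)%E ->
  orlicz_lorentz gamma phi w' `<=` orlicz_lorentz gamma phi w.
Proof.
move=> ww ww' K0 WK u [k k0 ku]; exists k; first exact: k0.
apply: (@le_lt_trans _ _ ((2 * K)%:E * modular gamma phi w' (k *: u))%E).
  apply: (weighted_integral_le_of_primitive ww ww' K0 WK).
    exact: orlicz_rearr_noninc.
  by move=> *; exact: orlicz_rearr_ge0.
apply: (lte_mul_pinfty _ _ ku); last by [].
by rewrite lee_fin; apply: mulr_ge0; [exact: ler0n|exact: ltW].
Qed.

End orlicz_lorentz_spaces.

(** * A decreasing function outside all the smaller spaces *)

Lemma nneseries_ge_term (R : realType) (u : nat -> \bar R) n :
  (forall i, 0 <= u i)%E -> (u n <= \sum_(i <oo) u i)%E.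
Proof.
move=> u0; rewrite (@nneseriesD1 _ _ n)//; apply: leeDl.
by apply: nneseries_ge0.
Qed.

Section profile.
Context (R : realType) (gamma : \bar R) (phi : R -> R).
Hypothesis phiO : orlicz_function phi.
Local Notation I0 := (leb_oitv gamma).
Local Notation fmod := (fun_modular gamma phi).
Local Notation orearr := (orlicz_rearr gamma phi).

Lemma weighted_emeasurable w u : weight gamma w -> noninc_on gamma u ->
  measurable_fun (I0 : set (LT R)) (fun t => u t * (w t)%:E)%E.
Proof.
move=> ww ud; apply: emeasurable_funM; last exact: weight_emeasurable.
exact: noninc_measurable.
Qed.

Lemma weighted_integral_ge0 w u : weight gamma w ->
  (forall t, I0 t -> 0 <= u t)%E -> (0 <= weighted_integral gamma w u)%E.
Proof.
move=> ww u0; apply: integral_ge0 => t It; apply: mule_ge0; first exact: u0.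
exact: weight_ge0 It.
Qed.

Lemma fun_modular_ge0 w f : weight gamma w -> (0 <= fmod w f)%E.
Proof.
by move=> ww; apply: weighted_integral_ge0 => // t _; exact: orlicz_rearr_ge0.
Qed.

Lemma fun_modular_scale w f (k : R) : weight gamma w -> 0 < k <= 1 ->
  (fmod w (fun t => k * f t)%R <= k%:E * fmod w f)%E.
Proof.
move=> ww k01; have k0 : 0 < k by case/andP: k01.
have mI := @leb_oitv_measurable R gamma.
have mf g := weighted_emeasurable ww (orlicz_rearr_noninc (gamma := gamma) phiO g).
have ge0 g t : I0 t -> (0 <= orearr g t * (w t)%:E)%E.
  by move=> It; apply: mule_ge0; [exact: orlicz_rearr_ge0|exact: weight_ge0 It].
rewrite /fun_modular /weighted_integral.
rewrite -(ge0_integralZl_EFin _ mI (ge0 f) (mf f) (ltW k0)).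
apply: (ge0_le_integral _ mI (ge0 _) (mf _)).
  by apply: measurable_funeM; exact: mf.
move=> t It; rewrite muleA; apply: lee_wpmul2r; first exact: weight_ge0 It.
rewrite /orlicz_rearr rearrZ//; apply: orlicz_ext_starshaped => //.
exact: rearr_ge0.
Qed.

(** A decreasing integrable family that is infinite at one point is infinite on an
interval, where its integral would diverge. *)
Lemma weighted_integral_fin w u : weight gamma w -> noninc_on gamma u ->
  (forall t, I0 t -> 0 <= u t)%E -> (weighted_integral gamma w u < +oo)%E ->
  forall t, I0 t -> (u t < +oo)%E.
Proof.
move=> ww ud u0 uoo t It; rewrite ltNge leye_eq; apply/eqP => ut.
have t0 : 0 < t by case: It.
pose J : set (LT R) := `]0, t[%classic.
have mJ : lmeasurable J by exact/lmeasurable_interval/interval_is_interval.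
have JI : J `<=` I0.
  by move=> s; rewrite /J/= in_itv/= => /andP[s0 st]; exact: leb_oitv_le (ltW st) It.
move: uoo; apply/negP; rewrite -leNgt.
apply: (@le_trans _ _ (\int[leb]_(s in J) (u s * (w s)%:E))%E); last first.
  apply: (ge0_subset_integral _ mJ (@leb_oitv_measurable R gamma) _ _ JI).
    exact: weighted_emeasurable ww ud.
  by move=> s Is; apply: mule_ge0; [exact: u0|exact: weight_ge0 Is].
rewrite (eq_integral (cst +oo%E)).
  have lJ : leb J = t%:E by rewrite leb_itv_oo ?subr0// ltW.
  have -> : (\int[leb]_(s in J) cst +oo s = +oo)%E.
    by transitivity (+oo * leb J)%E; [exact: integral_cst|rewrite lJ gt0_mulye].
  by [].
move=> s /set_mem Js; have Is := JI _ Js.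
move: Js; rewrite /J/= in_itv/= => /andP[s0 st].
have -> : u s = +oo%E by apply/eqP; rewrite -leye_eq -ut; apply: ud => //; exact: ltW.
by rewrite gt0_mulye// lte_fin (weight_pos ww).
Qed.

Lemma orlicz_rearr_bound (x : \bar R) (r : R) :
  (0 <= x -> orlicz_ext phi x <= r%:E -> x <= (Num.max 1 (r / phi 1))%:E)%E.
Proof.
case: x => [s| |]//=; rewrite ?lee_fin ?leNye// => s0 sr.
rewrite le_max; have [s1|s1] := leP s 1 => //=.
rewrite ler_pdivlMr ?(orlicz_gt0 phiO)//.
by apply: le_trans sr; apply: orlicz_growth => //; exact: ltW.
Qed.

(** One decreasing function [h] with finite modular dominates a positive multiple of
every [(f n)^*]: the multiples are chosen with summable modulars, and [h] is half of
their supremum. The factor one half makes some term of the supremum exceed [h t], so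
that [phi (h t)] is at most the sum of the values of [phi] at the terms. *)
Lemma dominating_profile (w : R -> R) (wn : nat -> R -> R) (f : nat -> L0 gamma) :
  (0 < gamma)%E ->
  weight gamma w -> (forall n, weight gamma (wn n)) ->
  (forall n, orlicz_lorentz gamma phi w (f n)) ->
  (forall n, ~ orlicz_lorentz gamma phi (wn n) (f n)) ->
  exists h : R -> R, [/\ (forall t, 0 <= h t),
    (forall t, ~ I0 t -> h t = 0),
    (forall s t, I0 s -> I0 t -> s <= t -> h t <= h s) &
    [/\ (weighted_integral gamma w (fun t => (phi (h t))%:E) < +oo)%E,
    (forall n, exists2 c : R, 0 < c & forall t, I0 t ->
      (c%:E * rearrangement gamma (ae_repr (f n)) t <= (h t)%:E)%E) &
    (exists2 t, I0 t & 0 < h t)]].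
Proof.
move=> g0 ww wwn fX fnX.
have [c cP] : {c : nat -> R & forall n, 0 < c n /\
    (fmod w (fun t => c n * ae_repr (f n) t)%R <=
     (1 / (2 ^ n.+1)%:R)%:E)%E}.
  apply: (@choice _ _ (fun n c => 0 < c /\
    (fmod w (fun t => c * ae_repr (f n) t)%R <=
     (1 / (2 ^ n.+1)%:R)%:E)%E)) => n.
  have /(orlicz_lorentzP phiO _ ww)[k k0] := fX n.
  set A := fmod w _ => Aoo.
  have A0 : (0 <= A)%E by exact: fun_modular_ge0.
  have Afin : A \is a fin_num by rewrite ge0_fin_numE.
  pose a := fine A; have a0 : 0 <= a by exact: fine_ge0.
  pose e : R := 1 / (2 ^ n.+1)%:R.
  have e0 : 0 < e by rewrite divr_gt0// ltr0n expn_gt0.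
  (* scaling by [th] multiplies the modular [a] by at most [th], hence brings it below
     [e] *)
  pose th := Num.min 1 (e / (1 + a)).
  have a1 : 0 < 1 + a by rewrite ltr_wpDr.
  have th0 : 0 < th by rewrite lt_min ltr01 divr_gt0.
  have th1 : 0 < th <= 1 by rewrite th0 ge_min lexx.
  exists (th * k); split; first exact: mulr_gt0.
  rewrite (_ : (fun t => _) = fun t => th * (k * ae_repr (f n) t)); last first.
    by apply/funext => t; rewrite mulrA.
  apply: le_trans (fun_modular_scale _ ww th1) _.
  rewrite -/A -(fineK Afin) -EFinM lee_fin -/a -/e.
  apply: (@le_trans _ _ (e / (1 + a) * a)).
    by rewrite ler_wpM2r// ge_min lexx orbT.
  by rewrite -mulrA ler_piMr ?(ltW e0)// mulrC ler_pdivrMr// mul1r lerDr.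
pose x n t := rearrangement gamma (fun t => c n * ae_repr (f n) t) t.
have x0 n t : (0 <= x n t)%E by exact: rearr_ge0.
pose U t := (\sum_(n <oo) orlicz_ext phi (x n t))%E.
have p0 n t : (0 <= orlicz_ext phi (x n t))%E by exact: orlicz_ext_ge0.
have xU n t : (orlicz_ext phi (x n t) <= U t)%E.
  by apply: (@nneseries_ge_term _ (fun n => orlicz_ext phi (x n t))) => i.
have U0 t : (0 <= U t)%E by exact: le_trans (xU 0%N t).
have Ud : noninc_on gamma U.
  move=> s t Is It st; apply: lee_nneseries => // n _.
  exact: orlicz_rearr_noninc.
have mI := @leb_oitv_measurable R gamma.
have Uoo : (weighted_integral gamma w U < +oo)%E.
  have -> : weighted_integral gamma w U =
      (\sum_(n <oo) fmod w (fun t => c n * ae_repr (f n) t)%R)%E.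
    rewrite /fun_modular /weighted_integral -(integral_nneseries _ mI); last 2 first.
    - move=> n; apply: weighted_emeasurable => //; exact: orlicz_rearr_noninc.
    - move=> n t It; apply: mule_ge0; last exact: weight_ge0 It.
      exact: orlicz_rearr_ge0.
    apply: eq_integral => t /set_mem It; rewrite muleC -nneseriesZl//.
    by apply: eq_eseriesr => n _; rewrite muleC.
  apply: (@le_lt_trans _ _ 1%E); last exact: ltry.
  have := @epsilon_trick R (fun=> 0%E) 1 xpredT (fun=> lexx _) ler01.
  rewrite [X in (_ <= X + _)%E]eseries0// add0e; apply: le_trans.
  apply: lee_nneseries => [*|n *]; first exact: fun_modular_ge0.
  by rewrite add0e; case: (cP n).
have Ufin t : I0 t -> (U t < +oo)%E.
  by apply: (weighted_integral_fin ww Ud _ Uoo).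
pose S t := ereal_sup (range (x ^~ t)).
have xS n t : (x n t <= S t)%E by apply: ereal_sup_ubound; exists n.
have S0 t : (0 <= S t)%E by exact: le_trans (xS 0%N t).
have Sfin t : I0 t -> S t \is a fin_num.
  move=> It; rewrite ge0_fin_numE//.
  have UF : U t \is a fin_num by rewrite ge0_fin_numE// Ufin.
  apply: (@le_lt_trans _ _ (Num.max 1 (fine (U t) / phi 1))%:E); last exact: ltry.
  apply: ge_ereal_sup => _ [n _ <-]; apply: orlicz_rearr_bound => //.
  by rewrite fineK.
pose h t := if `[< I0 t >] then fine (S t) / 2 else 0.
have hE t : I0 t -> (h t * 2)%:E = S t.
  by move=> It; rewrite /h asboolT// divfK// fineK// Sfin.
have h0 t : 0 <= h t by rewrite /h; case: ifP => // _; rewrite divr_ge0// fine_ge0.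
have phih t : I0 t -> ((phi (h t))%:E <= U t)%E.
  move=> It; have [->|hN0] := eqVneq (h t) 0; first by rewrite (orlicz0 phiO).
  have h_gt0 : 0 < h t by rewrite lt_neqAle eq_sym hN0 h0.
  have : ((h t)%:E < S t)%E by rewrite -(hE t It) lte_fin; move: h_gt0; lra.
  move=> /ereal_sup_gt[_ [n _ <-] hx]; apply: le_trans (xU n t).
  by have := orlicz_ext_homo phiO _ (ltW hx); apply; rewrite lee_fin.
exists h; split; first exact: h0.
- by move=> t nIt; rewrite /h asboolF.
- move=> s t Is It st; rewrite -(ler_pM2r (ltr0n _ 2)) -lee_fin !hE//.
  apply: ge_ereal_sup => _ [n _ <-]; apply: le_trans (xS n s).
  exact: rearr_noninc.
split.
- apply: le_lt_trans Uoo; apply: (ge0_le_integral _ mI).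
  + move=> t It; apply: mule_ge0; last exact: weight_ge0 It.
    by rewrite lee_fin (orlicz_ge0 phiO).
  + apply: weighted_emeasurable => // s t Is It st; rewrite lee_fin.
    apply: (orlicz_homo phiO) => //.
    rewrite -(ler_pM2r (ltr0n _ 2)) -lee_fin !hE//.
    apply: ge_ereal_sup => _ [n _ <-]; apply: le_trans (xS n s).
    exact: rearr_noninc.
  + exact: weighted_emeasurable.
  + move=> t It; apply: lee_wpmul2r; first exact: weight_ge0 It.
    exact: phih.
- move=> n; exists (c n / 2); first by rewrite divr_gt0//; case: (cP n).
  move=> t It; rewrite mulrC EFinM -muleA lee_pdivrMl// -EFinM mulrC (hE t It).
  by apply: le_trans (xS n t); rewrite /x rearrZ//; case: (cP n).
- apply: contrapT => nh; apply: (fnX 0%N).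
  have hz t : I0 t -> h t = 0.
    move=> It; apply/eqP; rewrite eq_le h0 andbT leNgt; apply/negP => ht.
    by apply: nh; exists t.
  apply/(orlicz_lorentzP phiO _ (wwn 0%N)); exists (c 0%N).
    by case: (cP 0%N).
  rewrite (_ : fmod _ _ = 0%E)//; apply: integral0_eq => t It.
  have x00 : x 0%N t = 0%E.
    apply/eqP; rewrite eq_le x0 andbT; apply: le_trans (xS _ _) _.
    by rewrite -(hE t It) hz// mul0r.
  by rewrite /orlicz_rearr -/(x 0%N t) x00 /= (orlicz0 phiO) mul0e.
Qed.

End profile.

(** * A partition of positive density at every scale *)

(** On the positive half-line the class [j = i] is the union over [k : int] of the
intervals on which [k + exp (-i - 1) < ln t <= k + exp (-i)]. Being invariant under
multiplication of [t] by [exp 1], it fills a proportion of [(0, tau)] that stays away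
from 0 as [tau] varies. *)
Lemma scale_invariant_partition (R : realType) : exists j : R -> nat,
  (forall i, lmeasurable (j @^-1` [set i])) /\
  (forall i, exists2 c : R, 0 < c & forall tau, 0 < tau ->
     ((c * tau)%:E <= leb (j @^-1` [set i] `&` `]0%R, tau[%classic))%E).
Proof.
pose frac (y : R) := y - (Num.floor y)%:~R.
pose j (t : R) := Num.truncn (- ln (frac (ln t))).
have floor_frac (k : int) (r : R) : 0 <= r < 1 -> frac (k%:~R + r) = r.
  move=> /andP[r0 r1]; rewrite /frac (@floor_def _ _ k); first by rewrite addrC addKr.
  by rewrite intrD lerDl r0 ltrD2l.
exists j; split=> i.
  apply: sub_caratheodory.
  rewrite (_ : _ @^-1` _ = (fun t : R => - ln (frac (ln t))) @^-1`
    [set z | Num.truncn z = i])//.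
  have mf : measurable_fun setT (fun t : R => - ln (frac (ln t))).
    apply: measurable_funN; apply: measurableT_comp; first exact: measurable_ln.
    apply: (@measurableT_comp _ _ _ _ _ _ frac); last exact: measurable_ln.
    apply: measurable_funB; first exact: measurable_id.
    apply: nondecreasing_measurable => // x y xy.
    by rewrite ler_int; exact: le_floor.
  rewrite -[X in measurable X]setTI; apply: mf => //.
  apply: is_interval_measurable => x y /= xi yi z /andP[xz zy].
  by apply/eqP; rewrite eqn_leq -{1}yi -xi !le_truncn.
pose a : R := expR (- i.+1%:R); pose b : R := expR (- i%:R).
have ab : a < b by rewrite ltr_expR ltrN2 ltr_nat.
have a0 : 0 < a by exact: expR_gt0.
have b1 : b <= 1 by rewrite -expR0 ler_expR oppr_le0 ler0n.
have dab : 0 < expR b - expR a by rewrite subr_gt0 ltr_expR.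
exists (expR (- 2) * (expR b - expR a)) => [|tau tau0].
  by rewrite mulr_gt0// expR_gt0.
(* the last period of [ln t] that lies entirely below [ln tau] *)
pose k : int := Num.floor (ln tau) - 1.
have /andP[k1 k2] : k%:~R + 1 <= ln tau < k%:~R + 2.
  have := floor_itv (ln tau); rewrite /k intrD intrB => /andP[? ?].
  by apply/andP; split; lra.
pose J : set R := `]expR (k%:~R + a), expR (k%:~R + b)[%classic.
apply: (@le_trans _ _ (leb (J : set (LT R)))).
  rewrite leb_itv_oo; last by rewrite ler_expR lerD2l ltW.
  rewrite lee_fin !expRD -mulrBr -mulrA [_ * tau]mulrC mulrA ler_wpM2r ?(ltW dab)//.
  rewrite -(lnK tau0) -expRD ler_expR; lra.
apply: leb_mono => t; rewrite /J/= !in_itv/= => /andP[at_ tb].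
have t0 : 0 < t by apply: lt_trans at_; exact: expR_gt0.
have {}at_ : k%:~R + a < ln t by rewrite -ltr_expR lnK.
have {}tb : ln t < k%:~R + b by rewrite -ltr_expR lnK.
split; last by rewrite t0 /= -ltr_ln//; lra.
pose r := ln t - k%:~R.
have ra : a < r by rewrite /r; lra.
have rb : r < b by rewrite /r; lra.
have r0 : 0 < r by exact: lt_trans ra.
rewrite /= /j (_ : ln t = k%:~R + r); last by rewrite /r; lra.
rewrite floor_frac; last by rewrite (ltW r0) (lt_le_trans rb).
apply: truncn_def; rewrite lerNr ltrNl.
by rewrite -ler_expR -ltr_expR lnK// (ltW rb) ra.
Qed.

(** * Step functions over the partition *)

Section step_functions.
Context (R : realType) (gamma : \bar R) (phi : R -> R).
Hypothesis phiO : orlicz_function phi.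
Local Notation I := (leb_itv gamma).
Local Notation I0 := (leb_oitv gamma).
Local Notation fmod := (fun_modular gamma phi).
Local Notation rearr := (rearrangement gamma).

Variables (h : R -> R) (j : R -> nat).
Hypothesis h0 : forall t, 0 <= h t.
Hypothesis h_out : forall t, ~ I0 t -> h t = 0.
Hypothesis h_noninc : forall s t, I0 s -> I0 t -> s <= t -> h t <= h s.
Hypothesis mj : forall i, lmeasurable (j @^-1` [set i]).
Hypothesis j_density : forall i, exists2 c : R, 0 < c & forall tau, 0 < tau ->
  ((c * tau)%:E <= leb (j @^-1` [set i] `&` `]0%R, tau[%classic))%E.

Definition step (a : nat -> R) (t : R) : R := h t * a (j t).

Lemma step_measurable a : measurable_fun setT (step a : LT R -> R).
Proof.
apply: measurable_funM.
  have -> : h = (h : LT R -> R) \_ I0.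
    apply/funext => t; rewrite patchE; case: ifPn => // /negP tI.
    by apply: h_out => It; apply: tI; exact: mem_set.
  have mI := @leb_oitv_measurable R gamma.
  apply/(measurable_restrictT _ mI)/measurable_EFinP.
  by apply: noninc_measurable => s t Is It st /=; rewrite lee_fin h_noninc.
move=> _ Y mY; rewrite setTI.
rewrite (_ : _ @^-1` Y = \bigcup_i (if `[< Y (a i) >] then j @^-1` [set i] else set0)).
  by apply: bigcupT_measurable => i; case: ifP.
apply/seteqP; split=> t /=.
  by move=> Yt; exists (j t) => //; rewrite asboolT.
by move=> [i _]; case: asboolP => // Yi /= ->.
Qed.

Definition step_mfun a : {mfun LT R >-> R} := mfun_Sub (mem_set (step_measurable a)).

Definition step_class a : L0 gamma := to_L0 gamma (step_mfun a).

Lemma ae_repr_step a : ae_on gamma (fun t => ae_repr (step_class a) t = step a t).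
Proof. exact: ae_repr_class. Qed.

Lemma step_class_linear (k : R) a b :
  k *: step_class a + step_class b = step_class (fun i => k * a i + b i).
Proof.
apply/ae_repr_eqP.
have E1 : ae_on gamma (fun t => ae_repr (k *: step_class a) t = k * step a t).
  by apply: (ae_on2 _ (ae_reprZ k (step_class a)) (ae_repr_step a)) => t _ -> ->.
have E2 := ae_on2 (fun t _ (Ea : ae_repr (k *: step_class a) t = k * step a t)
  (Eb : ae_repr (step_class b) t = step b t) => conj Ea Eb) E1 (ae_repr_step b).
have E3 : ae_on gamma (fun t => ae_repr (k *: step_class a + step_class b) t =
    k * step a t + step b t).
  by apply: (ae_on2 _ E2 (ae_reprD (k *: step_class a) (step_class b)))
    => t _ [-> ->] ->.
apply: (ae_on2 _ E3 (ae_repr_step (fun i => k * a i + b i))) => t _ -> ->.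
by rewrite /step mulrDr mulrCA.
Qed.

Lemma step_class0 : step_class (fun=> 0) = 0.
Proof.
apply/ae_repr_eqP.
apply: (ae_on2 _ (ae_repr_step (fun=> 0)) (ae_repr0 gamma)) => t _ -> ->.
by rewrite /step mulr0.
Qed.

Lemma step_class_sum (s : seq (L0 gamma)) (c : L0 gamma -> R)
    (a : L0 gamma -> nat -> R) :
  (forall v, v \in s -> step_class (a v) = v) ->
  \sum_(v <- s) c v *: v = step_class (fun i => \sum_(v <- s) c v * a v i).
Proof.
elim: s => [|v s IH] sE.
  rewrite big_nil -step_class0; congr step_class.
  by apply/funext => i; rewrite big_nil.
rewrite big_cons IH; last by move=> u us; apply: sE; rewrite inE us orbT.
rewrite -[X in _ *: X + _](sE v (mem_head _ _)) step_class_linear; congr step_class.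
by apply/funext => i; rewrite big_cons.
Qed.

(** A sequence is recovered from its step function, because every class of [j] meets
every interval [(0, tau)], hence the set [{h > 0}], in positive measure. *)
Lemma step_class_eq0 a : (exists2 t, I0 t & 0 < h t) -> step_class a = 0 ->
  forall i, a i = 0.
Proof.
move=> [t1 It1 ht1] a0 i; apply/eqP/negPn/negP => ai.
have [c c0 /(_ t1)] := j_density i; have t10 : 0 < t1 by case: It1.
move=> /(_ t10); apply/negP; rewrite -ltNge.
apply: (@le_lt_trans _ _ 0%E); last by rewrite lte_fin mulr_gt0.
have aeE : ae_on gamma (fun t => step a t = 0).
  have := ae_repr_step a; rewrite a0 => E.
  by apply: (ae_on2 _ E (ae_repr0 gamma)) => t _ <- ->.
rewrite -(leb_negligible0 aeE); apply: leb_mono => t [jt].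
rewrite /= in_itv/= => /andP[t0 tt1].
have It : I0 t by exact: leb_oitv_le (ltW tt1) It1.
split; first by case: It => ? ?; split => //; exact: ltW.
move=> /eqP; rewrite /step mulf_eq0 jt (negbTE ai) orbF gt_eqF//.
by apply: lt_le_trans ht1 _; apply: h_noninc => //; exact: ltW.
Qed.

Lemma rearr_step_le a t : (forall i, `|a i| <= 1) -> I0 t ->
  (rearr (step a) t <= (h t)%:E)%E.
Proof.
move=> a1 It; have [t0 tg] := It.
apply/lee_addgt0Pr => e e0; rewrite -EFinD; apply: rearr_le.
  by rewrite ltr_wpDl.
have -> : t%:E = leb (`[0, t]%classic : set (LT R)).
  transitivity (lebesgue_measure `[0, t]%classic) => //.
  by rewrite lebesgue_measure_itv/= lte_fin t0 -EFinB subr0.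
apply: leb_mono => s [[s0 sg] /= hs]; rewrite in_itv/= s0 /= leNgt.
apply/negP => ts.
have Is : I0 s by split => //; exact: lt_trans ts.
have : `|step a s| <= h s by rewrite /step normrM (ger0_norm (h0 s)) ler_piMr.
have := h_noninc It Is (ltW ts); move: hs e0; move: `|_| => x; lra.
Qed.

Lemma h_orlicz_noninc : noninc_on gamma (fun t => (phi (h t))%:E).
Proof.
move=> s t Is It st; rewrite lee_fin; apply: (orlicz_homo phiO) => //.
exact: h_noninc.
Qed.

Lemma step_class_orlicz_lorentz w a : weight gamma w ->
  (weighted_integral gamma w (fun t => (phi (h t))%:E) < +oo)%E ->
  (forall i, `|a i| <= 1) -> orlicz_lorentz gamma phi w (step_class a).
Proof.
move=> ww hoo a1; apply/(orlicz_lorentz_class phiO _ ww); exists 1; first exact: ltr01.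
apply: (@le_lt_trans _ _
  (1%:E * weighted_integral gamma w (fun t => (phi (h t))%:E))%E).
  apply: (weighted_integral_dilation ww).
  - exact: orlicz_rearr_noninc.
  - exact: h_orlicz_noninc.
  - by move=> *; exact: orlicz_rearr_ge0.
  - by move=> t _; rewrite lee_fin (orlicz_ge0 phiO).
  - exact: lexx.
  move=> t It; rewrite divr1.
  rewrite (_ : (fun t => 1 * step_mfun a t) = step a); last first.
    by apply/funext => s; rewrite mul1r.
  apply: (orlicz_ext_homo phiO _ (rearr_step_le a1 It)); exact: rearr_ge0.
by rewrite mul1e.
Qed.

(** If the [i]-th coefficient is nonzero, then [f] exceeds a multiple of [h t] on the
part of class [i] inside [(0, t)], which has measure at least [c t > t / C]. *)
Lemma rearr_step_ge a (f : R -> R) i :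
  ae_on gamma (fun t => f t = step a t) ->
  exists2 C : R, 1 <= C & forall k t, 0 < k -> I0 t ->
    ((k * `|a i| * h t)%:E <= rearr (fun t => k * f t)%R (t / C)%R)%E.
Proof.
move=> fa; have [c c0 dens] := j_density i.
pose C := 1 + c^-1; have C1 : 1 <= C by rewrite lerDl invr_ge0 ltW.
exists C => // k t k0 It; have [t0 tg] := It.
set m := k * `|a i| * h t.
have tC : t / C < c * t.
  rewrite ltr_pdivrMr; last exact: lt_le_trans ltr01 C1.
  by rewrite /C mulrDr mulr1 mulrAC divff ?gt_eqF// mul1r ltrDr mulr_gt0.
apply/lee_addgt0Pr => e e0; rewrite -leeBlDr// -EFinB.
apply: rearr_ge; apply: (@lt_le_trans _ _ (c * t)%:E); first by rewrite lte_fin.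
apply: le_trans (dens t t0) _.
rewrite -[leRHS]adde0 -[in leRHS](leb_negligible0 fa).
apply: le_trans (leb_setU_le _ _); apply: leb_mono => s [js].
rewrite /= in_itv/= => /andP[s0 st].
have Is : I0 s by exact: leb_oitv_le (ltW st) It.
have Is' : I s by case: Is => _ sg; split => //; exact: ltW.
have [fs|fs] := pselect (f s = step a s); last by right; split.
left; split => //=; rewrite fs /step js !normrM (gtr0_norm k0) (ger0_norm (h0 s)).
have := h_noninc Is It (ltW st); rewrite /m => hts.
have : k * `|a i| * h t <= k * (h s * `|a i|).
  by rewrite [h s * _]mulrC mulrA ler_wpM2l// mulr_ge0// ltW.
by move: (k * (h s * _)) (k * _ * _) e0 => x y e0 xy; lra.
Qed.

(** A finite modular of [k] times the step function would bound, by [rearr_step_ge],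
the modular of [k |a i| c v]. *)
Lemma step_not_orlicz_lorentz w (v : L0 gamma) a i : weight gamma w ->
  (exists2 c : R, 0 < c & forall t, I0 t ->
     (c%:E * rearr (ae_repr v) t <= (h t)%:E)%E) ->
  ~ orlicz_lorentz gamma phi w v -> a i != 0 ->
  ~ orlicz_lorentz gamma phi w (step_class a).
Proof.
move=> ww [c c0 ch] nv ai /(orlicz_lorentzP phiO _ ww)[k k0 koo]; apply: nv.
have [C C1 H] := rearr_step_ge i (ae_repr_step a).
have b0 : 0 < k * `|a i| * c by rewrite !mulr_gt0// normr_gt0.
apply/(orlicz_lorentzP phiO _ ww); exists (k * `|a i| * c); first exact: b0.
apply: (@le_lt_trans _ _
    (C%:E * fmod w (fun t => k * ae_repr (step_class a) t)%R)%E); last first.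
  apply: lte_mul_pinfty koo; rewrite ?lee_fin ?(le_trans ler01)//.
apply: (weighted_integral_dilation ww).
- exact: orlicz_rearr_noninc.
- exact: orlicz_rearr_noninc.
- by move=> *; exact: orlicz_rearr_ge0.
- by move=> *; exact: orlicz_rearr_ge0.
- exact: C1.
move=> t It; apply: (orlicz_ext_homo phiO); first exact: rearr_ge0.
apply: le_trans (H k t k0 It); rewrite rearrZ// EFinM -muleA [leRHS]EFinM.
by apply: lee_wpmul2l (ch t It); rewrite lee_fin mulr_ge0// ltW.
Qed.

End step_functions.

(** * Norm convergence *)

Section luxemburg_convergence.
Context (R : realType) (gamma : \bar R) (phi : R -> R).
Hypothesis phiO : orlicz_function phi.
Local Notation I0 := (leb_oitv gamma).
Local Notation distr := (distribution_fun gamma).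

Lemma leb_oitv_small (d : R) : (0 < gamma)%E -> 0 < d -> exists2 t, I0 t & t <= d.
Proof.
case: gamma => [g| |]//; rewrite ?lte_fin => g0 d0.
- exists (Num.min d (g / 2)); last by rewrite ge_min lexx.
  split; first by rewrite lt_min d0 divr_gt0.
  by rewrite lte_fin gt_min; apply/orP; right; move: g0; lra.
- by exists d => //; split => //; exact: ltry.
Qed.

(** Convergence in norm implies convergence in measure. If [|u| > l] on a set of
measure more than [d], then [(u / e)^*] is at least [l / e] on [(0, d)], and the
modular of [u / e] is at least [phi (l / e)] times the weight of [(0, d)]; this
exceeds 1 for small [e]. *)
Lemma luxemburg_distr w (l d : R) : weight gamma w -> (0 < gamma)%E ->
  0 < l -> 0 < d ->
  exists2 e : R, 0 < e & forall u : L0 gamma,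
    (luxemburg_norm gamma phi w u < e%:E)%E -> (distr (ae_repr u) l <= d%:E)%E.
Proof.
move=> ww g0 l0 d0.
have [t It td] := leb_oitv_small g0 d0; have [t0 _] := It.
pose J : set (LT R) := `]0%R, t[%classic.
have mJ : lmeasurable J by exact/lmeasurable_interval/interval_is_interval.
have JI : J `<=` I0.
  by move=> s; rewrite /J/= in_itv/= => /andP[s0 st]; exact: leb_oitv_le (ltW st) It.
have lJ : leb J = t%:E by rewrite leb_itv_oo ?subr0// ltW.
pose m := w t * t.
have m0 : 0 < m by rewrite mulr_gt0// (weight_pos ww).
have p1 : 0 < phi 1 by exact: (orlicz_gt0 phiO).
(* by [orlicz_growth], [phi L * m >= L * phi 1 * m = phi 1 * m + 1] *)
pose L := 1 + (phi 1 * m)^-1.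
have L1 : 1 <= L by rewrite lerDl invr_ge0 mulr_ge0// ltW.
have L0' : 0 < L by exact: lt_le_trans ltr01 L1.
have pLm : 1 < phi L * m.
  apply: (@lt_le_trans _ _ (L * phi 1 * m)).
    have pm0 : 0 < phi 1 * m by exact: mulr_gt0.
    by rewrite -mulrA /L mulrDl mul1r mulVf ?gt_eqF// ltrDr.
  by rewrite ler_wpM2r ?(ltW m0)//; exact: orlicz_growth.
have wt0 : 0 <= w t := ltW (weight_pos ww It).
have pL0 : 0 <= phi L := orlicz_ge0 phiO (ltW L0').
exists (l / L) => [|u]; first by rewrite divr_gt0.
move=> /ereal_inf_lt[_ [e [e0 mod1] <-]]; rewrite lte_fin => el.
rewrite leNgt; apply/negP => dl; move: mod1; apply/negP; rewrite -ltNge.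
apply: (@lt_le_trans _ _ (fun_modular gamma phi w (fun s => e^-1 * ae_repr u s)%R));
  last first.
  apply: (fun_modular_le phiO ww); apply: ae_onS (ae_reprZ e^-1 u) => s _ ->.
  exact: lexx.
apply: (@lt_le_trans _ _ (\int[leb]_(s in J) (phi L * w t)%:E)%E).
  have -> : (\int[leb]_(s in J) (phi L * w t)%:E = (phi L * w t)%:E * leb J)%E.
    exact: integral_cst.
  by rewrite lJ -EFinM lte_fin -mulrA.
have mI := @leb_oitv_measurable R gamma.
have mf := weighted_emeasurable ww (orlicz_rearr_noninc (gamma := gamma) phiO
  (fun s => e^-1 * ae_repr u s)).
have f0 s : I0 s -> (0 <= orlicz_rearr gamma phi (fun s => e^-1 * ae_repr u s)%R s *
    (w s)%:E)%E.
  by move=> Is; apply: mule_ge0; [exact: orlicz_rearr_ge0|exact: weight_ge0 ww s Is].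
apply: le_trans (ge0_subset_integral _ mJ mI mf f0 JI).
apply: (ge0_le_integral _ mJ).
- by move=> s _; rewrite lee_fin; exact: mulr_ge0.
- exact: measurable_cst.
- exact: measurable_funS mI JI mf.
move=> s Js; have Is := JI _ Js.
move: Js; rewrite /J/= in_itv/= => /andP[s0 st].
rewrite EFinM; apply: lee_pmul; rewrite ?lee_fin.
- exact: pL0.
- exact: wt0.
- rewrite -[(phi L)%:E]/(orlicz_ext phi L%:E).
  apply: (orlicz_ext_homo phiO); first by rewrite lee_fin ltW.
  apply: (@le_trans _ _ (e^-1 * l)%:E).
    by rewrite lee_fin mulrC ler_pdivlMr// mulrC -ler_pdivlMr// ltW.
  apply: rearr_ge; rewrite distrZ ?invr_gt0//; apply: le_lt_trans dl.
  by rewrite lee_fin (le_trans (ltW st)).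
- exact: (weight_noninc ww Is It (ltW st)).
Qed.

(** A sequence converging fast enough in norm converges almost everywhere, by the
Borel-Cantelli lemma. *)
Lemma luxemburg_ae_cvg w : weight gamma w -> (0 < gamma)%E ->
  exists2 e : nat -> R, (forall n, 0 < e n) & forall (f : L0 gamma) (g : nat -> L0 gamma),
    (forall n, (luxemburg_norm gamma phi w (g n - f)%R < (e n)%:E)%E) ->
    ae_on gamma (fun t => ae_repr (g n) t @[n --> \oo] --> ae_repr f t).
Proof.
move=> ww g0.
pose r n : R := 1 / (2 ^ n.+1)%:R.
have r0 n : 0 < r n by rewrite divr_gt0// ltr0n expn_gt0.
have r_le n : r n <= n.+1%:R^-1.
  rewrite /r div1r lef_pV2 ?posrE ?ltr0n ?expn_gt0// ler_nat.
  by rewrite ltnW// ltn_expl.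
have [e eP] : {e : nat -> R & forall n, 0 < e n /\ forall u : L0 gamma,
    (luxemburg_norm gamma phi w u < (e n)%:E)%E ->
    (distr (ae_repr u) (r n) <= (r n)%:E)%E}.
  apply: (@choice _ _ (fun n e => 0 < e /\ forall u : L0 gamma,
    (luxemburg_norm gamma phi w u < e%:E)%E ->
    (distr (ae_repr u) (r n) <= (r n)%:E)%E)) => n.
  by have [e e0 eu] := luxemburg_distr ww g0 (r0 n) (r0 n); exists e.
exists e => [n|f g gf]; first by case: (eP n).
pose A n : set (LT R) :=
  leb_itv gamma `&` [set t | r n < `|ae_repr (g n - f) t|].
have mA n : lmeasurable (A n).
  apply: measurableI; first exact: measurable_leb_itv.
  rewrite (_ : [set t | _] =
      ae_repr (g n - f) @^-1` [set x | r n < `|x|]); last by [].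
  apply: measurable_funPTI.
  rewrite (_ : [set x | _] = (@Num.norm R R) @^-1` `]r n, +oo[%classic); last first.
    by apply/seteqP; split=> x /=; rewrite in_itv/= andbT.
  by rewrite -[X in measurable X]setTI; exact: normr_measurable.
have A0 : leb (lim_sup_set A) = 0%E.
  apply: lim_sup_set_cvg0 => //.
  apply: (@le_lt_trans _ _ 1%E); last exact: ltry.
  have := @epsilon_trick R (fun=> 0%E) 1 xpredT (fun=> lexx _) ler01.
  rewrite [X in (_ <= X + _)%E]eseries0// add0e; apply: le_trans.
  apply: lee_nneseries => [*|n *]; first exact: measure_ge0.
  by rewrite add0e; case: (eP n) => _; apply; exact: gf.
have nA : leb.-negligible (lim_sup_set A).
  apply/negligibleP => //; apply: bigcapT_measurable => n.
  by apply: bigcup_measurable => k _; exact: mA.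
have aeE n : ae_on gamma (fun t =>
    ae_repr (g n - f) t = ae_repr (g n) t - ae_repr f t).
  have := ae_reprZ (-1) f; rewrite scaleN1r => Ef.
  by apply: (ae_on2 _ Ef (ae_reprD (g n) (- f))) => t _ -> ->; rewrite mulN1r.
have nE : leb.-negligible (\bigcup_n (leb_itv gamma `&` [set t |
    ~ ae_repr (g n - f) t = ae_repr (g n) t - ae_repr f t])).
  by apply: negligible_bigcup => n; exact: aeE.
apply: negligibleS (negligibleU nA nE) => t [It /= ncvg].
apply: contrapT => nt; apply: ncvg.
have gE n : ae_repr (g n - f) t = ae_repr (g n) t - ae_repr f t.
  by apply: contrapT => h; apply: nt; right; exists n.
have [N Nt] : exists N, forall n, (N <= n)%N ->
    `|ae_repr (g n) t - ae_repr f t| <= r n.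
  apply: contrapT => /forallNP h; apply: nt; left => N _.
  have /existsNP[n /not_implyP[Nn rn]] := h N; exists n; first exact: Nn.
  split; first exact: It.
  by rewrite /= gE ltNge; exact/negP.
apply/cvgrPdist_lt => eps eps0; near=> n.
rewrite distrC; apply: le_lt_trans (Nt n _) _; first by near: n; exists N.
apply: (@le_lt_trans _ _ n.+1%:R^-1); last first.
  by near: n; exact: near_infty_natSinv_lt (PosNum eps0).
exact: r_le.
Unshelve. all: by end_near. Qed.

End luxemburg_convergence.

Section step_classes.
Context (R : realType) (gamma : \bar R) (phi : R -> R).
Hypothesis phiO : orlicz_function phi.
Local Notation I0 := (leb_oitv gamma).
Variables (h : R -> R) (j : R -> nat).
Hypothesis h0 : forall t, 0 <= h t.
Hypothesis h_out : forall t, ~ I0 t -> h t = 0.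
Hypothesis h_noninc : forall s t, I0 s -> I0 t -> s <= t -> h t <= h s.
Hypothesis mj : forall i, lmeasurable (j @^-1` [set i]).
Local Notation step_class := (step_class h_out h_noninc mj).

(** Where [h] vanishes all the functions vanish, hence so does the limit; elsewhere the coefficients of the
sequence converge, so that their pointwise limits represent the limit. *)
Lemma step_class_ae_lim (f : L0 gamma) (a : nat -> nat -> R) :
  ae_on gamma (fun t => ae_repr (step_class (a n)) t @[n --> \oo] --> ae_repr f t) ->
  exists b, f = step_class b.
Proof.
move=> af; pose b i := limn (fun n => a n i); exists b; apply/ae_repr_eqP.
have nE : ae_on gamma (fun t => forall n,
    ae_repr (step_class (a n)) t = step h j (a n) t).
  rewrite /ae_on (_ : _ `&` _ = \bigcup_n (leb_itv gamma `&` [set t |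
    ~ ae_repr (step_class (a n)) t = step h j (a n) t])).
    by apply: negligible_bigcup => n; exact: ae_repr_step.
  apply/seteqP; split=> t.
    by move=> [It /existsNP[n nt]]; exists n.
  by move=> [n _ [It nt]]; split => // /(_ n).
have fE : ae_on gamma (fun t =>
    ae_repr f t = step h j b t).
  apply: (ae_on2 _ nE af) => t _ En.
  rewrite (eq_cvg _ _ En) => cvf; rewrite /step.
  have [ht|ht] := eqVneq (h t) 0.
    have : (0 : R) @[n --> \oo] --> ae_repr f t.
      by move: cvf; rewrite /step ht; under eq_cvg do rewrite mul0r.
    move=> /(cvg_unique (@Rhausdorff R) (cvg_cst (0 : R))) <-.
    by rewrite ht mul0r.
  have cva : a n (j t) @[n --> \oo] --> (h t)^-1 * ae_repr f t.
    have : (h t)^-1 * step h j (a n) t @[n --> \oo] --> (h t)^-1 * ae_repr f t.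
      by apply: cvgM cvf; exact: cvg_cst.
    by under eq_cvg do rewrite /step mulKf//.
  by rewrite /b (cvg_lim _ cva)// mulVKf.
by apply: (ae_on2 _ fE (ae_repr_step h_out h_noninc mj b)) => t _ -> ->.
Qed.

End step_classes.

(** * Continuum many independent elements *)

(** Distinct geometric sequences are independent: a relation among them extends to
the values of all polynomials at the ratios, in particular of one that vanishes at
all ratios but one. *)
Lemma geometric_indep (F : fieldType) (T : eqType) (s : seq T) (x c : T -> F) :
  uniq s -> {in s &, injective x} ->
  (forall i, \sum_(v <- s) c v * x v ^+ i = 0) -> forall v, v \in s -> c v = 0.
Proof.
move=> us xinj c0 v vs.
have poly0 (p : {poly F}) : \sum_(u <- s) c u * p.[x u] = 0.
  under eq_bigr do rewrite horner_coef mulr_sumr.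
  rewrite exchange_big big1//= => i _.
  under eq_bigr do rewrite mulrCA.
  by rewrite -mulr_sumr c0 mulr0.
pose p := \prod_(u <- s | u != v) ('X - (x u)%:P).
have := poly0 p; rewrite (bigD1_seq v)//= big_seq_cond big1 ?addr0; last first.
  move=> u /andP[us' uv]; apply/eqP; rewrite mulf_eq0 horner_prod prodf_seq_eq0.
  by apply/orP; right; apply/hasP; exists u; rewrite // uv !hornerE subrr eqxx.
move/eqP; rewrite mulf_eq0 => /orP[/eqP//|].
rewrite horner_prod prodf_seq_eq0 => /hasP[u us' /andP[uv]].
by rewrite !hornerE subr_eq0 => /eqP/(xinj _ _ vs us') vu; rewrite vu eqxx in uv.
Qed.

(** Injecting the line into [(0, 1)], it provides the ratios of continuum many bounded
geometric sequences. *)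
Definition sigmoid (R : realType) (x : R) : R := (1 + expR x)^-1.

Lemma sigmoid_inj (R : realType) : injective (@sigmoid R).
Proof. by move=> x y /invr_inj/addrI; exact: expR_inj. Qed.

Lemma sigmoid_exp_le1 (R : realType) (x : R) i : `|sigmoid x ^+ i| <= 1.
Proof.
have e0 := expR_gt0 x; have e1 : 1 <= 1 + expR x by rewrite lerDl ltW.
have s0 : 0 <= sigmoid x by rewrite invr_ge0 (le_trans ler01).
by rewrite ger0_norm ?exprn_ge0// exprn_ile1// invf_le1// (lt_le_trans ltr01).
Qed.

Lemma card_eq_real (R : realType) (gamma : \bar R) (G : R -> L0 gamma)
    (B : set (L0 gamma)) :
  injective G -> range G `<=` B -> (B #= [set: R])%card.
Proof.
move=> Ginj GB; apply/card_eqPle; split.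
  exact: card_L0_le_real.
apply: (card_le_trans _ (subset_card_le GB)).
by have /card_eqPle[] := @inj_card_eq _ _ [set: R] G (in2W Ginj).
Qed.

Unset Implicit Arguments.

Theorem theorem4p10 (R : realType) (gamma : \bar R) (phi w : R -> R)
    (wn : nat -> R -> R) :
  (0 < gamma)%E ->
  orlicz_function phi ->
  (gamma = +oo%E -> delta2 phi) ->
  ((gamma < +oo)%E -> delta2_infty phi) ->
  weight gamma w ->
  (forall n, weight gamma (wn n)) ->
  (exists K : nat -> R, (forall n, 0 < K n) /\
    forall n t, leb_itv gamma t ->
      (primitive w t <= (K n)%:E * primitive (wn n) t)%E) ->
  (forall n, orlicz_lorentz gamma phi (wn n) `<`
             orlicz_lorentz gamma phi (wn n.+1)) ->
  let X := orlicz_lorentz gamma phi w in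
  let A := X `\` \bigcup_n orlicz_lorentz gamma phi (wn n) in
  maximal_spaceable X (luxemburg_norm gamma phi w) A /\
  spaceable X (luxemburg_norm gamma phi w) A [set: R].
Proof.
move=> g0 phiO _ _ ww wwn [K [K0 WK]] XX X A.
have XnX n : orlicz_lorentz gamma phi (wn n) `<=` X.
  exact: (orlicz_lorentz_sub phiO ww (wwn n) (K0 n) (WK n)).
have [f fP] : {f : nat -> L0 gamma & forall n, X (f n) /\
    ~ orlicz_lorentz gamma phi (wn n) (f n)}.
  apply: (@choice _ _ (fun n u => X u /\ ~ orlicz_lorentz gamma phi (wn n) u)) => n.
  have [_ /existsNP[u /not_implyP[uS nu]]] := XX n.
  by exists u; split; [exact: XnX uS|exact: nu].
have [h [h0 h_out h_noninc [hoo hf hpos]]] := dominating_profile phiO g0 ww wwn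
  (fun n => (fP n).1) (fun n => (fP n).2).
have [j [mj jd]] := scale_invariant_partition R.
pose st : (nat -> R) -> L0 gamma := step_class h_out h_noninc mj.
pose M : set (L0 gamma) := X `&` range st.
have Xsub : submod_closed (mem X) := orlicz_lorentz_submod phiO ww.
have Msub : submod_closed (mem M).
  split.
    apply/mem_set; split; first exact/set_mem/Xsub.1.
    by exists (fun=> 0); [exact: I|exact: step_class0].
  move=> k u v /set_mem[Xu [a _ au]] /set_mem[Xv [b _ bv]]; apply/mem_set; split.
    by apply/set_mem/Xsub.2; exact/mem_set.
  exists (fun i => k * a i + b i); first exact: I.
  by rewrite /st -step_class_linear -/st au bv.
have Mclosed : norm_closed X (luxemburg_norm gamma phi w) M.
  split=> [u []//|u Xu nMu].
  have [e e0 ecvg] := luxemburg_ae_cvg phiO ww g0.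
  (* otherwise elements of [M] within [e n] of [u] would converge to [u] a.e. *)
  apply: contrapT => nclosed.
  have [a aP] : {a : nat -> nat -> R & forall n,
      (luxemburg_norm gamma phi w (st (a n) - u)%R < (e n)%:E)%E}.
    apply: (@choice _ _ (fun n a =>
      (luxemburg_norm gamma phi w (st a - u)%R < (e n)%:E)%E)) => n.
    apply: contrapT => /forallNP far; apply: nclosed; exists (e n); first exact: e0.
    by move=> v _ vu [_ [a _ av]]; apply: (far a); rewrite av.
  have [b ub] := step_class_ae_lim (h_out := h_out) (h_noninc := h_noninc)
    (mj := mj) (f := u) (a := a) (ecvg u (fun n => st (a n)) aP).
  by apply: nMu; split; [exact: Xu|exists b; [exact: I|exact: esym ub]].
pose G x := st (fun i => sigmoid x ^+ i).
have GM : range G `<=` M.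
  move=> _ [x _ <-]; split; last by exists (fun i => sigmoid x ^+ i); [exact: I|].
  apply: (step_class_orlicz_lorentz phiO) => // i; exact: sigmoid_exp_le1.
have stinj a b : st a = st b -> a = b.
  move=> ab; apply/funext => i; apply/eqP; rewrite -subr_eq0; apply/eqP.
  have stab : st (fun i => a i - b i) = 0.
    rewrite (_ : (fun i => _) = fun i => -1 * b i + a i); last first.
      by apply/funext => k; rewrite mulN1r addrC.
    by rewrite /st -step_class_linear -/st ab scaleN1r addNr.
  exact: (step_class_eq0 jd hpos stab).
have Ginj : injective G.
  move=> x y /stinj/(congr1 (fun a => a 1%N)); rewrite !expr1; exact: sigmoid_inj.
have Gindep : lin_indep (range G).
  move=> s c us sG s0.
  have [r rG] : {r : L0 gamma -> R & forall v, v \in s -> G (r v) = v}.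
    apply: (@choice _ _ (fun v x => v \in s -> G x = v)) => v.
    have [vs|vs] := boolP (v \in s); last by exists 0.
    by have [x _ xv] := sG v vs; exists x.
  apply: (geometric_indep (x := fun v => sigmoid (r v)) us).
    by move=> u v us' vs /sigmoid_inj uv; rewrite -(rG u us') -(rG v vs) uv.
  move=> i; rewrite (step_class_sum (a := fun v i => sigmoid (r v) ^+ i) _ rG) in s0.
  exact: (step_class_eq0 jd hpos s0 i).
have MA : M `<=` A `|` [set 0].
  move=> u [Xu [a _ au]].
  have [[i ai]|/forallNP a0] := pselect (exists i, a i <> 0); last first.
    right; rewrite /= -au /st -(step_class0 h_out h_noninc mj).
    by congr step_class; apply/funext => i; exact: contrapT (a0 i).
  left; split; first exact: Xu.
  move=> [n _]; rewrite -au.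
  exact: (step_not_orlicz_lorentz phiO h0 jd (wwn n) (hf n) (fP n).2
    (introN eqP ai)).
have [B MB GB] := hamel_extension Msub Gindep GM.
have [B' XB' BB'] := hamel_extension Xsub Gindep (subset_trans GM (@subIsetl _ _ _)).
have BR : (B #= [set: R])%card := card_eq_real Ginj GB.
have B'R : (B' #= [set: R])%card := card_eq_real Ginj BB'.
split; last by exists M; split; [exact: Msub|exact: Mclosed|exists B|exact: MA].
exists B'; first exact: XB'.
exists M; split; [exact: Msub|exact: Mclosed| |exact: MA].
exists B; first exact: MB.
by apply: card_eq_trans BR _; rewrite card_eq_sym.
Qed.
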